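(* Let $\Psi$ be a stationary point process on $\mathbb{R}^d$ with intensity $\alpha\ge 1$. Assume that there are $c>0$ and $\theta\in[0,1)$ such that for each $n\in\mathbb{N}$ the $n$-th correlation function of $\Psi$ exists and is bounded by $n^{\theta n}c^n$. Assume also that there exist $c_1>0$ and $\delta>0$ such that $\mathbb{P}(\|\tau(\mathbb{Z}^d,\Psi,0)\|>r)\le c_1e^{-c_1^{-1}r^\delta}$ for all $r\ge 0$. Then there exists $c_2>0$ such that $$\mathbb{P}(F(\mathbb{Z}^d,\Psi,0)\not\subset B_r)\le c_2e^{-c_2^{-1}r^{\beta}},\quad r>0,$$ where $\beta:=\min\{(1-\theta)\delta,2d\}/(2d+1-\theta)$ and $B_r$ is the ball of radius $r$ centred at the origin.
   Context: $\mathbf{N}$ is the space of locally finite subsets $\varphi$ of $\mathbb{R}^d$, with the $\sigma$-field generated by the maps $\varphi\mapsto\varphi(B):=\mathrm{card}(\varphi\cap B)$, $B$ Borel. A point process is a random element of $\mathbf{N}$; it is stationary if $\Psi+x$ has the same distribution as $\Psi$ for all $x\in\mathbb{R}^d$, and then its intensity is $\alpha:=\mathbb{E}\Psi([0,1]^d)$. The $n$-th correlation function of $\Psi$ is the Lebesgue density on $(\mathbb{R}^d)^n$ of the measure $\mathbb{E}\sum^{\neq}_{x_1,\dots,x_n\in\Psi}\delta_{(x_1,\dots,x_n)}$ (sum over pairwise distinct points). $\|\cdot\|$ is the Euclidean norm, $\|\infty\|:=\infty$, and $B(z,r)$ is the closed ball with centre $z$ and radius $r$. Matching. Let $\varphi,\psi\in\mathbf{N}$.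 A point $p\in\varphi$ prefers $x\in\psi$ to $y\in\psi$ if $\|x-p\|<\|y-p\|$, or if $\|x-p\|=\|y-p\|$ and $x$ is lexicographically strictly smaller than $y$. A point $x\in\psi$ prefers $p\in\varphi$ to $q\in\varphi$ if $\|p-x\|<\|q-x\|$, or if $\|p-x\|=\|q-x\|$ and $p$ is lexicographically strictly greater than $q$. The mutual nearest neighbour matching $\tau(\varphi,\psi,\cdot)$ is defined as follows: put $\varphi_0:=\varphi$, $\psi_0:=\psi$. Given $\varphi_n,\psi_n$, for each pair $(p,x)\in\varphi_n\times\psi_n$ such that $p$ prefers $x$ to all other points of $\psi_n$ and $x$ prefers $p$ to all other points of $\varphi_n$, set $\tau(\varphi,\psi,p):=x$ and $\tau(\varphi,\psi,x):=p$; let $\varphi_{n+1}\subset\varphi_n$, $\psi_{n+1}\subset\psi_n$ be the points not matched in this step. Points of $\varphi_\infty:=\bigcap_n\varphi_n$ and $\psi_\infty:=\bigcap_n\psi_n$ are never matched and get $\tau(\varphi,\psi,x):=\infty$. For $x\notin\varphi\cup\psi$ put $\tau(\varphi,\psi,x):=x$. Matching flower. For $n\ge2$, a sequence $(z_1,\dots,z_n)$ is a descending chain in $(\varphi,\psi)$ if $z_i\in\varphi$ for odd $i$, $z_i\in\psi$ for even $i$, and $z_i$ prefers $z_{i+1}$ to $z_{i-1}$ for $2\le i\le n-1$. For $z\in\varphi$ with $\tau(\varphi,\psi,z)\neq\infty$, a competing chain for $z$ is a descending chain $c=(z_1,\dots,z_n)$ with $z_1=z$ such that $z_2$ equals $\tau(\varphi,\psi,z)$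 or is preferred by $z$ to $\tau(\varphi,\psi,z)$; put $F_c:=B(z_1,\|z_1-z_2\|)\cup\bigcup_{i=2}^nB(z_i,\|z_i-z_{i-1}\|)$. The matching flower is $F(\varphi,\psi,z):=\bigcup_cF_c$, the union over all competing chains $c$ for $z$. If $\tau(\varphi,\psi,z)=\infty$, then $F(\varphi,\psi,z):=\mathbb{R}^d$. *)

(* Defs.v *)
From HB Require Import structures.
From mathcomp Require Import all_boot all_order all_algebra.
From mathcomp Require Import all_classical all_reals all_analysis.
From mathcomp Require Import measurable_realfun.

Set Implicit Arguments.
Unset Strict Implicit.
Unset Printing Implicit Defensive.
Import Order.TTheory GRing.Theory Num.Theory.
Import numFieldNormedType.Exports.
Local Open Scope classical_set_scope.
Local Open Scope ring_scope.

(* R^d is 'rV[R]_d and (R^d)^n is 'M[R]_(n, d), the i-th point of an n-tuple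
   being its i-th row. The library's topology on matrices is the usual one, so
   the sigma-algebra below is the Borel sigma-algebra. The library's norm `|x|
   on matrices is the sup norm; the Euclidean norm is [enorm] below. *)
Section borel_matrix.
Context (R : realType) (m n : nat).

Let borel_mx : set (set 'M[R]_(m, n)) := <<s @open 'M[R]_(m, n) >>.

Let borel_mx0 : borel_mx set0. Proof. exact: sigma_algebra0. Qed.

Let borel_mxC A : borel_mx A -> borel_mx (~` A).
Proof. exact: sigma_algebraC. Qed.

Let borel_mx_bigcup (F : (set 'M[R]_(m, n))^nat) :
  (forall i, borel_mx (F i)) -> borel_mx (\bigcup_i F i).
Proof. exact: sigma_algebra_bigcup. Qed.

HB.instance Definition _ :=
  @isMeasurable.Build (sigma_display (@open 'M[R]_(m, n))) 'M[R]_(m, n)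
    borel_mx borel_mx0 borel_mxC borel_mx_bigcup.

End borel_matrix.

Section pushforward_sigma_finite.
Context d1 d2 (T1 : measurableType d1) (T2 : measurableType d2) (R : realType).
Variables (f : T1 -> T2) (g : T2 -> T1).
Hypotheses (mf : measurable_fun setT f) (mg : measurable_fun setT g).
Hypothesis fK : cancel f g.
Variable mu : {measure set T1 -> \bar R}.
Hypothesis sfmu : sigma_finite setT mu.

Let pf : set T2 -> \bar R := pushforward mu f.

Let pf0 : pf set0 = 0%E.
Proof. by rewrite /pf /pushforward preimage_set0 measure0. Qed.

Let pf_ge0 A : (0 <= pf A)%E.
Proof. exact: measure_ge0. Qed.

Let pf_sigma_additive : semi_sigma_additive pf.
Proof.
by move=> F mF tF mUF; exact: (measure_semi_sigma_additive F).
Qed.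

HB.instance Definition _ := isMeasure.Build _ _ _ pf
  pf0 pf_ge0 pf_sigma_additive.

Let pf_sigma_finite : sigma_finite setT pf.
Proof.
have [F FT Foo] := sfmu.
exists (fun n => g @^-1` (F n)); first by rewrite -preimage_bigcup -FT.
move=> n; have [mFn Fnoo] := Foo n; split.
  by rewrite -[X in measurable X]setTI; exact: mg.
rewrite /pf /pushforward (_ : f @^-1` _ = F n)//.
by apply/seteqP; split => x /=; rewrite fK.
Qed.

HB.instance Definition _ := Measure_isSigmaFinite.Build _ _ _ pf
  pf_sigma_finite.

Definition spushforward : {sigma_finite_measure set T2 -> \bar R} := pf.

End pushforward_sigma_finite.

(* The library's canonical sigma-finite structure on m1 \x m2 is shadowed by the
   one for subprobabilities. *)
Lemma sigma_finite_product d1 d2 (T1 : measurableType d1)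
    (T2 : measurableType d2) (R : realType)
    (m1 : {sigma_finite_measure set T1 -> \bar R})
    (m2 : {sigma_finite_measure set T2 -> \bar R}) :
  sigma_finite setT (m1 \x m2)%E.
Proof.
have /sigma_finiteP[F [TF ndF Foo]] := sigma_finiteT m1.
have /sigma_finiteP[G [TG ndG Goo]] := sigma_finiteT m2.
exists (fun n => F n `*` G n).
  rewrite -setXTT TF TG predeqE => -[x y]; split.
    move=> [/= [n _ Fnx] [k _ Gky]]; exists (maxn n k) => //; split.
    - by move: x Fnx; exact/subsetPset/ndF/leq_maxl.
    - by move: y Gky; exact/subsetPset/ndG/leq_maxr.
  by move=> [n _ []/= ? ?]; split; exists n.
move=> k; have [? ?] := Foo k; have [? ?] := Goo k.
split; first exact: measurableX.
by rewrite product_measure1E// lte_mul_pinfty// ge0_fin_numE.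
Qed.

Section lebesgue_matrix.
Context (R : realType).
Local Notation RT := (measurableTypeR R).

Definition tcons n (x : RT * n.-tuple RT) : n.+1.-tuple RT :=
  [tuple of x.1 :: x.2].

Definition tuncons n (t : n.+1.-tuple RT) : RT * n.-tuple RT :=
  (tnth t ord0, [tuple of behead t]).

Lemma measurable_tcons n : measurable_fun setT (@tcons n).
Proof. exact: measurable_cons. Qed.

Lemma measurable_tuncons n : measurable_fun setT (@tuncons n).
Proof.
apply/measurable_fun_pairP; split => /=.
  exact: measurable_tnth.
exact: measurable_behead.
Qed.

Lemma tconsK n : cancel (@tcons n) (@tuncons n).
Proof. by move=> [x t]; congr pair; apply/val_inj. Qed.

Definition lebesgue_tcons n
    (mu : {sigma_finite_measure set (n.-tuple RT) -> \bar R}) :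
    {sigma_finite_measure set (n.+1.-tuple RT) -> \bar R} :=
  spushforward (@measurable_tcons n) (@measurable_tuncons n) (@tconsK n)
    (sigma_finite_product (@lebesgue_measure R) mu).

Fixpoint lebesgue_tuple n : {sigma_finite_measure set (n.-tuple RT) -> \bar R} :=
  if n is n'.+1 then lebesgue_tcons (lebesgue_tuple n') else \d_[tuple].

Definition mx_of_tuple m n (t : (m * n).-tuple RT) : 'M[R]_(m, n) :=
  \matrix_(i, j) tnth t (mxvec_index i j).

Definition tuple_of_mx m n (A : 'M[R]_(m, n)) : (m * n).-tuple RT :=
  [tuple mxvec A ord0 k | k < m * n].

Lemma mx_of_tupleK m n : cancel (@mx_of_tuple m n) (@tuple_of_mx m n).
Proof.
move=> t; apply/eq_from_tnth => k; rewrite tnth_mktuple.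
by case/mxvec_indexP: k => i j; rewrite mxvecE mxE.
Qed.

Lemma measurable_tuple_of_mx m n : measurable_fun setT (@tuple_of_mx m n).
Proof.
apply/measurable_fun_tnthP => k.
rewrite (_ : _ \o _ = fun A : 'M[R]_(m, n) => mxvec A ord0 k); last first.
  by apply/funext => A /=; rewrite tnth_mktuple.
case/mxvec_indexP: k => i j; under eq_fun do rewrite mxvecE.
apply: (measurability _ (RGenOInfty.measurableE R)) => //.
move=> _ [_ [x ->] <-]; rewrite setTI; apply: sub_sigma_algebra.
apply: open_comp; [move=> A _; exact: coord_continuous|exact: interval_open].
Qed.

Lemma measurable_mx_of_tuple m n : measurable_fun setT (@mx_of_tuple m n).
Proof.
apply: (measurability (@open 'M[R]_(m, n))) => // _ [U oU <-]; rewrite setTI.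
pose B (i : 'M[rat]_(m, n) * nat) :=
  ball (map_mx ratr i.1 : 'M[R]_(m, n)) (i.2.+1%:R^-1 : R).
rewrite (_ : _ @^-1` U =
    \bigcup_i (if `[< B i `<=` U >] then @mx_of_tuple m n @^-1` B i else set0)).
  apply: countable_bigcupT_measurable => [|i]; first exact: countableP.
  case: ifP => // _.
  rewrite (_ : _ @^-1` B i = \bigcap_(kl in [set: 'I_m * 'I_n])
      [set t | ball (ratr (i.1 kl.1 kl.2) : R) (i.2.+1%:R^-1 : R)
         (tnth t (mxvec_index kl.1 kl.2))]).
    apply: fin_bigcap_measurable => // kl _.
    rewrite -[X in measurable X]setTI.
    exact: (@measurable_tnth _ RT _ _ measurableT _ (measurable_ball _ _)).
  apply/seteqP; split => t /=.
    by move=> [_ Bt] kl _; have := Bt kl.1 kl.2; rewrite !mxE.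
  by move=> Bt; split=> // k l; have := Bt (k, l) Logic.I; rewrite !mxE.
apply/seteqP; split => [t Ut|t [i _]]; last first.
  by case: ifPn => // /asboolP BU /= /BU.
set A := mx_of_tuple t in Ut *.
have /nbhs_ballP[e /= e0 eU] : nbhs A U by exact: open_nbhs_nbhs.
pose k := Num.truncn (e / 2)^-1.
have ke : k.+1%:R^-1 < e / 2 :> R.
  by rewrite invf_plt ?posrE ?divr_gt0// truncnS_gt.
have k0 : 0 < k.+1%:R^-1 :> R by rewrite invr_gt0.
have /fin_all_exists[q Aq] (kl : 'I_m * 'I_n) : exists p : rat,
    ball (A kl.1 kl.2) (k.+1%:R^-1 : R) (ratr p).
  have [p pA] := @rat_in_itvoo R (A kl.1 kl.2 - k.+1%:R^-1)
    (A kl.1 kl.2 + k.+1%:R^-1) ltac:(by rewrite ltrBlDr -addrA ltrDl addr_gt0).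
  by exists p; rewrite ball_itv.
exists (\matrix_(i, j) q (i, j), k) => //.
case: ifPn => [_|/asboolP[]] /=; first split=> // i j.
  by rewrite !mxE; apply: ball_sym; have := Aq (i, j); rewrite mxE.
move=> y [_ By]; apply: eU; split => // i j; rewrite (splitr e).
have qy : ball (ratr (q (i, j)) : R) (k.+1%:R^-1 : R) (y i j).
  by have := By i j; rewrite !mxE.
exact: ball_triangle (le_ball (ltW ke) (Aq (i, j))) (le_ball (ltW ke) qy).
Qed.

(* Lebesgue measure on the Borel sets of (R^n)^m *)
Definition lebesgue_mx m n : {sigma_finite_measure set 'M[R]_(m, n) -> \bar R} :=
  spushforward (@measurable_mx_of_tuple m n) (@measurable_tuple_of_mx m n)
    (@mx_of_tupleK m n) (sigma_finiteT (lebesgue_tuple (m * n))).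

End lebesgue_matrix.

Section configurations.
Context (R : realType) (d : nat).
Local Notation Rd := 'rV[R]_d.

Definition locally_finite (phi : set Rd) :=
  forall B : set Rd, bounded_set B -> finite_set (phi `&` B).

Record configuration := Configuration {
  points :> set Rd;
  points_locally_finite : locally_finite points }.

Let locally_finite0 : locally_finite set0.
Proof. by move=> B _; rewrite set0I. Qed.

HB.instance Definition _ := gen_eqMixin configuration.
HB.instance Definition _ := gen_choiceMixin configuration.
HB.instance Definition _ :=
  isPointed.Build configuration (Configuration locally_finite0).

Definition point_count (B : set Rd) (phi : configuration) : \bar R :=
  counting (phi `&` B).

Let count_preimages : set (set configuration) :=
  \bigcup_(B in [set B : set Rd | measurable B])
    preimage_set_system setT (point_count B) measurable.

Let conf_measurable : set (set configuration) := <<s count_preimages >>.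

Let conf_measurable0 : conf_measurable set0.
Proof. exact: sigma_algebra0. Qed.

Let conf_measurableC A : conf_measurable A -> conf_measurable (~` A).
Proof. exact: sigma_algebraC. Qed.

Let conf_measurable_bigcup (F : (set configuration)^nat) :
  (forall i, conf_measurable (F i)) -> conf_measurable (\bigcup_i F i).
Proof. exact: sigma_algebra_bigcup. Qed.

HB.instance Definition _ :=
  @isMeasurable.Build (sigma_display count_preimages) configuration
    conf_measurable conf_measurable0 conf_measurableC conf_measurable_bigcup.

Lemma locally_finite_translate (x : Rd) (phi : configuration) :
  locally_finite [set y | points phi (y - x)].
Proof.
move=> B bB.
have bBx : bounded_set [set y - x | y in B].
  have [M [Mr BM]] := bB; exists (M + `|x|); split; first exact: num_real.
  move=> r rM _ [y By <-]; apply: le_trans (ler_normB y x) _.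
  by rewrite -lerBrDr; apply: BM By; rewrite ltrBrDr.
have := finite_image (fun y => y + x) (points_locally_finite phi bBx).
apply: sub_finite_set => y [/= phiy By].
by exists (y - x); [split => //; exists y|rewrite subrK].
Qed.

Definition translate (x : Rd) (phi : configuration) : configuration :=
  Configuration (locally_finite_translate x phi).

(* Z^d *)
Definition lattice : set Rd := [set x | forall i, x ord0 i \is a Num.int].

Definition unit_cube : set Rd := [set x | forall i, 0 <= x ord0 i <= 1].

End configurations.
Arguments lattice {R d}.
Arguments unit_cube {R d}.

Section point_processes.
Context (R : realType) (d : nat).
Context (dO : measure_display) (Omega : measurableType dO).
Context (P : probability Omega R) (Psi : {RV P >-> configuration R d}).

Definition stationary := forall (x : 'rV[R]_d) (A : set (configuration R d)),
  measurable A ->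
  P [set w | A (translate x (Psi w))] = P [set w | A (Psi w)].

Definition intensity : \bar R := (\int[P]_w point_count unit_cube (Psi w))%E.

Definition distinct_tuples n (phi : set 'rV[R]_d) : set 'M[R]_(n, d) :=
  [set x | injective (fun i => row i x) /\ forall i, phi (row i x)].

(* E sum^{<>}_{x_1, ..., x_n in Psi} delta_(x_1, ..., x_n) *)
Definition factorial_moment_measure n (A : set 'M[R]_(n, d)) : \bar R :=
  (\int[P]_w \esum_(x in distinct_tuples (Psi w)) \d_x A)%E.

Definition is_correlation_function n (rho : 'M[R]_(n, d) -> \bar R) :=
  [/\ measurable_fun setT rho,
      forall x, (0 <= rho x)%E &
      forall A, measurable A ->
        factorial_moment_measure A = (\int[@lebesgue_mx R n d]_(x in A) rho x)%E].

End point_processes.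

Section matching.
Context (R : realType) (d : nat).
Local Notation Rd := 'rV[R]_d.
Implicit Types (phi psi : set Rd) (p q x y z : Rd).

Definition enorm x : R := Num.sqrt (\sum_i x ord0 i ^+ 2).

Definition cball z (r : R) : set Rd := [set y | enorm (y - z) <= r].

Definition lex_lt x y := exists i : 'I_d,
  x ord0 i < y ord0 i /\ forall j : 'I_d, (j < i)%N -> x ord0 j = y ord0 j.

(* a point p of the first set prefers x to y *)
Definition prefers1 p x y :=
  enorm (x - p) < enorm (y - p) \/
  enorm (x - p) = enorm (y - p) /\ lex_lt x y.

(* a point x of the second set prefers p to q *)
Definition prefers2 x p q :=
  enorm (p - x) < enorm (q - x) \/
  enorm (p - x) = enorm (q - x) /\ lex_lt q p.

Definition mutual_nearest phi psi p x :=
  [/\ phi p, psi x,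
      forall y, psi y -> y <> x -> prefers1 p x y &
      forall q, phi q -> q <> p -> prefers2 x p q].

Fixpoint unmatched phi psi n : set Rd * set Rd :=
  if n is n'.+1 then
    let: (phi', psi') := unmatched phi psi n' in
    ([set p | phi' p /\ ~ exists x, mutual_nearest phi' psi' p x],
     [set x | psi' x /\ ~ exists p, mutual_nearest phi' psi' p x])
  else (phi, psi).

Definition matched phi psi p x := exists n,
  mutual_nearest (unmatched phi psi n).1 (unmatched phi psi n).2 p x.

Definition partner phi psi z y := matched phi psi z y \/ matched phi psi y z.

(* None stands for the point at infinity. The partner is unique: a point of
   both sets is at distance 0 from itself, hence is its own partner. *)
Definition tau phi psi z : option Rd :=
  if pselect ((phi `|` psi) z) is left _ then
    if pselect (exists y, partner phi psi z y) is left h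
    then Some (projT1 (cid h)) else None
  else Some z.

Definition enorm_oo (z : option Rd) : \bar R :=
  if z is Some x then (enorm x)%:E else +oo%E.

(* Chains are functions of which only the values at 1, ..., n matter. *)
Definition descending_chain phi psi n (c : nat -> Rd) :=
  [/\ (2 <= n)%N,
      forall i, (1 <= i <= n)%N -> if odd i then phi (c i) else psi (c i) &
      forall i, (2 <= i <= n.-1)%N ->
        if odd i then prefers1 (c i) (c i.+1) (c i.-1)
        else prefers2 (c i) (c i.+1) (c i.-1)].

Definition competing_chain phi psi z n (c : nat -> Rd) :=
  [/\ descending_chain phi psi n c, c 1%N = z &
      exists t, tau phi psi z = Some t /\ (c 2%N = t \/ prefers1 z (c 2%N) t)].

Definition chain_region n (c : nat -> Rd) : set Rd :=
  cball (c 1%N) (enorm (c 1%N - c 2%N)) `|`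
  \bigcup_(i in [set i | (2 <= i <= n)%N]) cball (c i) (enorm (c i - c i.-1)).

Definition flower phi psi z : set Rd :=
  if tau phi psi z is Some _ then
    [set y | exists n c, competing_chain phi psi z n c /\ chain_region n c y]
  else setT.

End matching.

(* Main.v *)
(* If the flower is not contained in B_r while the partner of 0 is within distance
   s of 0, then some competing chain has a point outside B_(r - s). Its steps are
   nonincreasing and at most s; cutting out loops keeps this and makes the points
   of Psi pairwise distinct. So there are n ~ r / (2s) distinct points x_k of Psi
   and lattice points p_k with p_0 = 0, |x_k - p_k| nonincreasing and at most s,
   |p_(k+1) - x_k| <= s. There are at most (5s)^d choices for each p_(k+1) - p_k.
   Cutting the ball of radius s into n shells of equal volume, the shells of the
   x_k - p_k form one of at most 4^n monotone sequences, and each of those has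
   volume (kappa s^d / n)^n. The first moment method thus bounds the probability by
   (C s^(2d) n^(theta - 1))^n, which is at most e^(-n) for s = eps r^g with
   g = (1 - theta) / (2d + 1 - theta), while the hypothesis on the partner gives
   exp(- c s^delta).

   A measure has arbitrary values on nonmeasurable sets, so the events in question
   must be shown to be measurable: the points of a configuration are exactly those
   isolated by some rational ball, which turns every quantifier over points,
   matching rounds and chains into a countable one. *)
Require Import Defs.
From HB Require Import structures.
From mathcomp Require Import all_boot all_order all_algebra.
From mathcomp Require Import all_classical all_reals all_analysis.
From mathcomp Require Import measurable_realfun.
From mathcomp Require Import zify ring lra.

Set Implicit Arguments.
Unset Strict Implicit.
Unset Printing Implicit Defensive.
Import Order.TTheory GRing.Theory Num.Theory.
Import numFieldNormedType.Exports.
Local Open Scope classical_set_scope.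
Local Open Scope ring_scope.

(** * Lebesgue measure *)

Section affine_line.
Variable R : realType.
Local Notation RT := (measurableTypeR R).
Variables (a b : R).
Hypothesis a0 : 0 < a.

Let phi (x : RT) : RT := a * x + b.

Let mphi : measurable_fun setT phi.
Proof.
apply: measurable_funD; last exact: measurable_cst.
apply: measurable_funM => //; exact: measurable_cst.
Qed.

(** The scaled pushforward of Lebesgue measure along [phi] agrees with Lebesgue measure on half-open
    intervals, and these determine it. *)
Lemma lebesgue_measure_affine (A : set RT) : measurable A ->
  (lebesgue_measure A = a%:E * lebesgue_measure (phi @^-1` A))%E.
Proof.
move=> mA.
pose a' := NngNum (ltW a0).
pose mu : {measure set RT -> \bar R} :=
  mscale a' (Measure.clone _ _ _ (pushforward (@lebesgue_measure R) phi)
     (measure_function_pushforward__canonical__measure_function_Measure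
        (@lebesgue_measure R) mphi)).
rewrite (_ : (_ * _)%E = mu A)//.
apply: lebesgue_measure_unique => // _ [[x y]] _ <-.
rewrite /mu/= /mscale/= /pushforward.
rewrite (_ : _ @^-1` _ = [set` `](x - b) / a, (y - b) / a]]); last first.
  apply/seteqP; split => z; rewrite /= !in_itv/= /phi ltr_pdivrMr// ler_pdivlMr//.
    by rewrite ltrBlDr lerBrDr [z * a]mulrC.
  by rewrite ltrBlDr lerBrDr [z * a]mulrC.
rewrite !lebesgue_measure_itv/= !lte_fin ltr_pM2r ?invr_gt0// ltrD2r.
case: ifP => _; last by rewrite mule0.
rewrite -EFinB -EFinM; congr EFin; field; exact: lt0r_neq0.
Qed.

Lemma ge0_integral_affine (f : RT -> \bar R) :
  measurable_fun setT f -> (forall x, (0 <= f x)%E) ->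
  (\int[@lebesgue_measure R]_x f x =
   a%:E * \int[@lebesgue_measure R]_x f (phi x))%E.
Proof.
move=> mf f0.
pose a' := NngNum (ltW a0).
pose nu : {measure set RT -> \bar R} :=
  Measure.clone _ _ _ (pushforward (@lebesgue_measure R) phi)
     (measure_function_pushforward__canonical__measure_function_Measure
        (@lebesgue_measure R) mphi).
rewrite (eq_measure_integral (mscale a' nu)); last first.
  by move=> A mA _; rewrite [LHS]lebesgue_measure_affine.
rewrite ge0_integral_mscale//; congr (_ * _)%E.
by rewrite ge0_integral_pushforward ?preimage_setT.
Qed.

End affine_line.

Section lebesgue_tuple_theory.
Variable R : realType.
Local Notation RT := (measurableTypeR R).
Local Notation leb := (@lebesgue_measure R).
Local Notation "'lam' n" := (@lebesgue_tuple R n) (at level 10, n at level 8).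

Definition tsection n (A : set (n.+1.-tuple RT)) (x : RT) : set (n.-tuple RT) :=
  [set t | A (tcons (x, t))].

Lemma xsection_tcons n (A : set (n.+1.-tuple RT)) x :
  xsection (@tcons R n @^-1` A) x = tsection A x.
Proof. by rewrite /xsection; apply/seteqP; split => t /=; rewrite inE. Qed.

Lemma measurable_tcons_preimage n (A : set (n.+1.-tuple RT)) :
  measurable A -> measurable (@tcons R n @^-1` A).
Proof. by move=> mA; rewrite -[X in measurable X]setTI; exact: measurable_tcons. Qed.

Lemma measurable_tsection n (A : set (n.+1.-tuple RT)) x :
  measurable A -> measurable (tsection A x).
Proof.
move=> mA; rewrite -xsection_tcons; apply: measurable_xsection.
exact: measurable_tcons_preimage.
Qed.

Lemma measurable_fun_tsection n (A : set (n.+1.-tuple RT)) :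
  measurable A -> measurable_fun setT (fun x => lam n (tsection A x)).
Proof.
move=> mA.
under eq_fun do rewrite -xsection_tcons.
by apply: measurable_fun_xsection; exact: measurable_tcons_preimage.
Qed.

Lemma lebesgue_tupleS n (A : set (n.+1.-tuple RT)) :
  (lam n.+1 A = \int[leb]_x lam n (tsection A x))%E.
Proof.
transitivity ((leb \x lam n)%E (@tcons R n @^-1` A)); first by [].
by apply: eq_integral => x _ /=; rewrite xsection_tcons.
Qed.

(** The offsets are a sequence rather than a tuple, so that dropping the first coordinate just
    replaces [b] by [b \o succn]. *)
Definition taffine n (a : R) (b : nat -> R) (t : n.-tuple RT) : n.-tuple RT :=
  [tuple a * tnth t i + b i | i < n].

Lemma measurable_taffine n a b : measurable_fun setT (@taffine n a b).
Proof.
apply/measurable_fun_tnthP => i.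
rewrite (_ : _ \o _ = fun t : n.-tuple RT => a * tnth t i + b i :> RT); last first.
  by apply/funext => t /=; rewrite tnth_mktuple.
apply: measurable_funD; last exact: measurable_cst.
apply: measurable_funM; first exact: measurable_cst.
exact: measurable_tnth.
Qed.

Lemma measurable_taffine_preimage n a b (A : set (n.-tuple RT)) :
  measurable A -> measurable (taffine a b @^-1` A).
Proof. by move=> mA; rewrite -[X in measurable X]setTI; exact: measurable_taffine. Qed.

Lemma taffine_tcons n a b x (t : n.-tuple RT) :
  taffine a b (tcons (x, t)) = tcons (a * x + b 0%N, taffine a (b \o succn) t).
Proof.
apply/eq_from_tnth => i; rewrite tnth_mktuple.
case: (unliftP ord0 i) => [j ->|->].
  by rewrite !tnthS tnth_mktuple.
by rewrite !tnth0.
Qed.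

(** Induction on the dimension: the change of variables on the line treats the first coordinate, the
    induction hypothesis treats the sections. *)
Lemma lebesgue_tuple_affine n a b (A : set (n.-tuple RT)) : 0 < a ->
  measurable A ->
  (lam n A = (a ^+ n)%:E * lam n (taffine a b @^-1` A))%E.
Proof.
move=> a0; elim: n b A => [|n IHn] b A mA.
  rewrite expr0 mul1e; congr (lam 0%N _).
  by apply/seteqP; split => t /=; rewrite [taffine _ _ _]tuple0 [t]tuple0.
rewrite !lebesgue_tupleS (@ge0_integral_affine _ a (b 0%N)) //; last first.
  exact: measurable_fun_tsection.
under eq_integral => x _.
  rewrite (IHn (b \o succn)); last exact: measurable_tsection.
  rewrite (_ : _ @^-1` _ = tsection (taffine a b @^-1` A) x); last first.
    by apply/seteqP; split => t /=; rewrite /tsection /= taffine_tcons.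
  over.
rewrite ge0_integralZl//; first by rewrite muleA -EFinM -exprS.
- by apply: measurable_fun_tsection; exact: measurable_taffine_preimage.
- by rewrite lee_fin exprn_ge0// ltW.
Qed.

Definition tleft m n (t : (m + n).-tuple RT) : m.-tuple RT :=
  [tuple tnth t (lshift n i) | i < m].
Definition tright m n (t : (m + n).-tuple RT) : n.-tuple RT :=
  [tuple tnth t (rshift m i) | i < n].

Lemma tleft_tcons m n x (t : (m + n).-tuple RT) :
  @tleft m.+1 n (tcons (x, t)) = tcons (x, tleft t).
Proof.
apply/eq_from_tnth => i; rewrite tnth_mktuple.
case: (unliftP ord0 i) => [j ->|->].
  have -> : lshift n (lift ord0 j : 'I_m.+1) =
    (lift ord0 (lshift n j : 'I_(m + n)) : 'I_(m + n).+1) by exact/val_inj.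
  by rewrite !tnthS tnth_mktuple.
have -> : lshift n (ord0 : 'I_m.+1) = (ord0 : 'I_(m + n).+1) by exact/val_inj.
by rewrite !tnth0.
Qed.

Lemma tright_tcons m n x (t : (m + n).-tuple RT) :
  @tright m.+1 n (tcons (x, t)) = tright t.
Proof.
apply/eq_from_tnth => i; rewrite !tnth_mktuple.
have -> : rshift m.+1 i = (lift ord0 (rshift m i) : 'I_(m + n).+1) by exact/val_inj.
by rewrite tnthS.
Qed.

(** Induction on [m], because [lebesgue_tuple] is built by adding coordinates on the left: fixing
    the first coordinate cuts [A] and leaves [B] alone. *)
Lemma lebesgue_tuple_prod m n (A : set (m.-tuple RT)) (B : set (n.-tuple RT)) :
  measurable A -> measurable B ->
  (lam (m + n) [set t | A (tleft t) /\ B (tright t)] = lam m A * lam n B)%E.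
Proof.
elim: m A => [|m IHm] A mA mB.
  have tl t : @tleft 0 n t = [tuple] by rewrite [LHS]tuple0.
  have tr t : @tright 0 n t = t.
    apply: eq_from_tnth => i; rewrite tnth_mktuple.
    by congr (tnth _ _); exact/val_inj.
  have -> : lam 0 A = \d_[tuple] A by [].
  rewrite diracE; have [A0|A0] := boolP (_ \in A).
    rewrite inE in A0; rewrite mul1e; congr (lebesgue_tuple _ n _); apply/seteqP.
    by split => t /=; rewrite tl tr//; case.
  rewrite mul0e (_ : [set _ | _] = set0) ?measure0//.
  by apply/seteqP; split => t //= []; rewrite tl => /mem_set; rewrite (negbTE A0).
rewrite [LHS](@lebesgue_tupleS (m + n)) [in RHS]lebesgue_tupleS.
rewrite -ge0_integralZr//; last exact: measurable_fun_tsection.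
apply: eq_integral => x _; rewrite -IHm//; last exact: measurable_tsection.
congr (lebesgue_tuple _ _ _); apply/seteqP.
by split => t; rewrite /tsection/= tleft_tcons tright_tcons.
Qed.

End lebesgue_tuple_theory.

Lemma index_allpairs_pair (S T : eqType) (s : seq S) (t : seq T) x y :
  x \in s -> y \in t ->
  index (x, y) [seq (a, b) | a <- s, b <- t] = (index x s * size t + index y t)%N.
Proof.
elim: s => // a s IHs; rewrite inE => xs yt /=.
rewrite index_cat size_map eq_sym; have [ax|ax] := eqVneq x a.
  rewrite -ax map_f// mul0n add0n.
  by rewrite (index_map (f := fun b => (x, b)))// => u v [].
rewrite (negbTE ax) /= in xs.
rewrite ifF ?IHs ?mulSn ?addnA//.
by apply/negbTE/mapP => -[b _ [xa _]]; rewrite xa eqxx in ax.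
Qed.

(** [mxvec_index] comes from the enumeration of a product of ordinals; its row-major value is what
    identifies the first [d] entries of a vectorized matrix with row 0. *)
Lemma val_mxvec_index m n (i : 'I_m) (j : 'I_n) :
  mxvec_index i j = (i * n + j)%N :> nat.
Proof.
rewrite /mxvec_index /=.
transitivity (index (i, j) (enum {: 'I_m * 'I_n})).
  rewrite -[in RHS](nth_enum_rank (i, j) (i, j)) index_uniq ?enum_uniq//.
  by rewrite -cardE ltn_ord.
rewrite enumT unlock /= /prod_enum.
by rewrite index_allpairs_pair ?mem_enum// !index_enum_ord size_enum_ord.
Qed.

Lemma measurable_coord (R : realType) m n (i : 'I_m) (j : 'I_n) :
  measurable_fun setT (fun x : 'M[R]_(m, n) => x i j).
Proof.
apply: (measurability _ (RGenOInfty.measurableE R)) => //.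
move=> _ [_ [x ->] <-]; rewrite setTI; apply: sub_sigma_algebra.
apply: open_comp; [move=> A _; exact: coord_continuous|exact: interval_open].
Qed.

Section lebesgue_rows.
Variables (R : realType) (d : nat).
Local Notation RT := (measurableTypeR R).
Local Notation "'lam' n" := (@lebesgue_tuple R n) (at level 10, n at level 8).

Definition row_tuple n (x : 'M[R]_(n, d)) i : d.-tuple RT := [tuple x i j | j < d].

Lemma mx_of_tuple_row0 n (t : (d + n * d).-tuple RT) :
  row_tuple (@mx_of_tuple R n.+1 d t) ord0 = tleft t.
Proof.
apply: eq_from_tnth => j; rewrite !tnth_mktuple mxE.
by congr (tnth _ _); apply: ord_inj; rewrite val_mxvec_index mul0n.
Qed.

Lemma mx_of_tuple_rowS n (t : (d + n * d).-tuple RT) i :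
  row_tuple (@mx_of_tuple R n.+1 d t) (lift ord0 i) =
  row_tuple (@mx_of_tuple R n d (tright t)) i.
Proof.
apply: eq_from_tnth => j; rewrite !tnth_mktuple !mxE tnth_mktuple.
congr (tnth _ _); apply: ord_inj.
transitivity (d + mxvec_index i j)%N => //.
by rewrite !val_mxvec_index lift0 mulSn addnA.
Qed.

Lemma measurable_row_tuple n (i : 'I_n) :
  measurable_fun setT (fun x : 'M[R]_(n, d) => row_tuple x i).
Proof.
apply/measurable_fun_tnthP => j.
rewrite (_ : _ \o _ = fun x : 'M[R]_(n, d) => x i j); first exact: measurable_coord.
by apply/funext => x /=; rewrite tnth_mktuple.
Qed.

Lemma measurable_rows n (T : 'I_n -> set (d.-tuple RT)) :
  (forall i, measurable (T i)) ->
  measurable [set x : 'M[R]_(n, d) | forall i, T i (row_tuple x i)].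
Proof.
move=> mT.
rewrite (_ : [set _ | _] = \bigcap_(i in [set: 'I_n])
   ((fun x : 'M[R]_(n, d) => row_tuple x i) @^-1` T i)); last first.
  by apply/seteqP; split => [x h i _|x h i]; apply: h.
apply: fin_bigcap_measurable => // i _.
by rewrite -[X in measurable X]setTI; exact: measurable_row_tuple.
Qed.

(** Induction on the number of rows: in row-major order row 0 is the left block of [d] coordinates,
    and the other rows form the right block. *)
Lemma lebesgue_mx_rows n (T : 'I_n -> set (d.-tuple RT)) :
  (forall i, measurable (T i)) ->
  (lebesgue_mx R n d [set x | forall i, T i (row_tuple x i)] =
   \prod_(i < n) lam d (T i))%E.
Proof.
elim: n T => [|n IHn] T mT.
  rewrite big_ord0.
  transitivity (\d_([tuple] : 0.-tuple RT) (@mx_of_tuple R 0 d @^-1`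
    [set x | forall i, T i (row_tuple x i)]) : \bar R) => //.
  rewrite (_ : _ @^-1` _ = setT) ?diracT//.
  by apply/seteqP; split => // t _ [].
rewrite big_ord_recl -IHn//.
pose B : set ((n * d).-tuple RT) :=
  @mx_of_tuple R n d @^-1` [set x | forall i, T (lift ord0 i) (row_tuple x i)].
transitivity (lam (d + n * d) [set t | T ord0 (tleft t) /\ B (tright t)]).
  congr (lebesgue_tuple _ _ _); apply/seteqP; split => t /=.
    move=> h; split; first by rewrite -mx_of_tuple_row0; exact: h.
    by move=> i; rewrite -mx_of_tuple_rowS; exact: h.
  move=> [h0 hS] i; case: (unliftP ord0 i) => [j ->|->].
    by rewrite mx_of_tuple_rowS; exact: hS.
  by rewrite mx_of_tuple_row0.
rewrite lebesgue_tuple_prod//.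
rewrite -[X in measurable X]setTI; apply: measurable_mx_of_tuple => //.
exact: (@measurable_rows n (fun i => T (lift ord0 i))).
Qed.

End lebesgue_rows.

Lemma measurable_sqrt (R : realType) : measurable_fun setT (@Num.sqrt R).
Proof. by apply: continuous_measurable_fun; exact: sqrt_continuous. Qed.

Section cube.
Variable R : realType.
Local Notation RT := (measurableTypeR R).
Local Notation "'lam' n" := (@lebesgue_tuple R n) (at level 10, n at level 8).

Definition tcube n : set (n.-tuple RT) := [set t | forall i, - 1 <= (tnth t i : R) <= 1].

Lemma measurable_tcube n : measurable (@tcube n).
Proof.
rewrite (_ : @tcube n = \bigcap_(i in [set: 'I_n])
   ((fun t : n.-tuple RT => tnth t i) @^-1` [set` `[-1, 1]])); last first.
  by apply/seteqP; split => [x h i|x h i] => [_|]; have := h i; rewrite /= in_itv; apply.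
apply: fin_bigcap_measurable => // i _.
by rewrite -[X in measurable X]setTI; apply: measurable_tnth.
Qed.

(** The cube contains the unit ball, whose volume is thereby finite. *)
Lemma lebesgue_tcube_fin n : (lam n (@tcube n) < +oo)%E.
Proof.
elim: n => [|n IHn].
  apply: (@le_lt_trans _ _ 1%E); last exact: ltry.
  rewrite [X in (X <= _)%E](_ : _ = \d_[tuple] (@tcube 0))// diracE lee_fin.
  by case: (_ \in _).
rewrite [X in (X < _)%E](_ : _ =
  ((@lebesgue_measure R) \x lam n)%E ([set` `[-1, 1]] `*` @tcube n)); last first.
  rewrite [LHS](_ : _ =
    ((@lebesgue_measure R) \x lam n)%E (@tcons R n @^-1` @tcube n.+1))//.
  congr ((_ \x _)%E _); apply/seteqP; split => -[x t] /=.
    move=> h; split; first by have := h ord0; rewrite tnth0 in_itv.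
    by move=> i; have := h (lift ord0 i); rewrite tnthS.
  move=> [hx ht] i; case: (unliftP ord0 i) => [j ->|->].
    by rewrite tnthS.
  by rewrite tnth0; move: hx; rewrite in_itv.
rewrite product_measure1E//; last exact: measurable_tcube.
rewrite [X in (X * _)%E](_ : _ = (1 + 1 : R)%:E).
  by rewrite lte_mul_pinfty// lee_fin.
apply: etrans (lebesgue_measure_itv `[-1, 1]) _.
by rewrite /= lte_fin ifT ?opprK// ltrN10.
Qed.

End cube.

Section shells.
Variables (R : realType) (d : nat).
Hypothesis d0 : (0 < d)%N.
Local Notation RT := (measurableTypeR R).
Local Notation "'lam' n" := (@lebesgue_tuple R n) (at level 10, n at level 8).

Definition tnorm (t : d.-tuple RT) (p : nat -> R) : R :=
  Num.sqrt (\sum_(i < d) (tnth t i - p i) ^+ 2).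

Lemma measurable_tnorm p : measurable_fun setT (tnorm ^~ p : _ -> R).
Proof.
apply: (measurableT_comp (@measurable_sqrt R)).
apply: measurable_sum => i; apply: measurable_funX; apply: measurable_funB => //.
exact: measurable_tnth.
Qed.

(** Measuring size by the d-th power of the distance makes the volume linear in [u]. *)
Definition tball (p : nat -> R) (u : R) : set (d.-tuple RT) := [set t | tnorm t p ^+ d < u].

Lemma measurable_tball p u : measurable (tball p u).
Proof.
rewrite -[X in measurable X]setTI.
apply: (measurable_funX d (measurable_tnorm p) measurableT) (_ : measurable [set x | x < u]).
by rewrite (_ : [set _ | _] = [set` `]-oo, u[])//; apply/seteqP; split => x; rewrite /= in_itv.
Qed.

Lemma lebesgue_tball_affine p (a u : R) : 0 < a ->
  (lam d (tball p (a ^+ d * u)) = (a ^+ d)%:E * lam d (tball (fun=> 0%R) u))%E.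
Proof.
move=> a0; rewrite (lebesgue_tuple_affine p a0); last exact: measurable_tball.
congr (_ * lebesgue_tuple _ _ _)%E; apply/seteqP.
suff E t : tnorm (taffine a p t) p = a * tnorm t (fun=> 0%R).
  by split => t; rewrite /tball /= E exprMn ltr_pM2l// exprn_gt0.
rewrite /tnorm; under eq_bigr do rewrite tnth_mktuple addrK -[tnth t _]subr0 exprMn.
by rewrite -mulr_sumr sqrtrM ?sqr_ge0// sqrtr_sqr gtr0_norm.
Qed.

Lemma lebesgue_tball_fin : (lam d (tball (fun=> 0%R) 1) < +oo)%E.
Proof.
apply: le_lt_trans (lebesgue_tcube_fin R d).
apply: le_measure; rewrite ?inE; [exact: measurable_tball|exact: measurable_tcube|].
move=> t; rewrite /tball /= => t1 i.
have : tnorm t (fun=> 0%R) < 1.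
  by rewrite ltNge; apply/negP => /(exprn_ege1 d); rewrite leNgt t1.
rewrite -ler_norml => /ltW; apply: le_trans.
rewrite /tnorm -sqrtr_sqr ler_wsqrtr// (bigD1 i)//= subr0 lerDl.
by apply: sumr_ge0 => j _; exact: sqr_ge0.
Qed.

(** The volume of the Euclidean unit ball. *)
Definition kappa : R := fine (lam d (tball (fun=> 0%R) 1)).

Lemma kappa_ge0 : 0 <= kappa.
Proof. exact: fine_ge0. Qed.

Lemma lebesgue_tball p (u : R) : 0 <= u -> lam d (tball p u) = (kappa * u)%:E.
Proof.
rewrite le_eqVlt => /predU1P[<-|u0].
  rewrite mulr0 (_ : tball p 0 = set0) ?measure0//.
  by apply/seteqP; split => t //=; rewrite /tball /= ltNge exprn_ge0 ?sqrtr_ge0.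
(* The ball is the unit ball scaled by the d-th root of [u]. *)
have ud : (u `^ d%:R^-1) ^+ d = u.
  by rewrite -powR_mulrn ?powR_ge0// -powRrM mulVf ?powRr1 ?ltW// pnatr_eq0 -lt0n.
rewrite -[in LHS]ud -[_ ^+ d]mulr1 lebesgue_tball_affine ?powR_gt0// ud.
by rewrite mulrC EFinM fineK// ge0_fin_numE// lebesgue_tball_fin.
Qed.

(** Cutting at equal steps of the d-th power of the distance gives all shells the same volume,
    whatever [j]. *)
Definition shell (p : nat -> R) (v : R) (j : nat) : set (d.-tuple RT) :=
  [set t | j%:R * v <= tnorm t p ^+ d < j.+1%:R * v].

Lemma shellE p v j : shell p v j = tball p (j.+1%:R * v) `\` tball p (j%:R * v).
Proof.
apply/seteqP; split => t; rewrite /shell /tball /=.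
  by move=> /andP[h1 h2]; split => //; apply/negP; rewrite -leNgt.
by move=> [h1 /negP]; rewrite -leNgt => ->.
Qed.

Lemma measurable_shell p v j : measurable (shell p v j).
Proof. by rewrite shellE; apply: measurableD; exact: measurable_tball. Qed.

Lemma lebesgue_shell p (v : R) j : 0 <= v -> lam d (shell p v j) = (kappa * v)%:E.
Proof.
move=> v0; rewrite shellE measureD; try exact: measurable_tball.
  rewrite setIidr; last first.
    move=> t; rewrite /tball /= => h; apply: lt_le_trans h _.
    by rewrite ler_wpM2r// ler_nat.
  transitivity ((kappa * (j.+1%:R * v))%:E - (kappa * (j%:R * v))%:E)%E.
    by congr (_ - _)%E; apply: lebesgue_tball; rewrite mulr_ge0.
  by rewrite -EFinB; congr EFin; rewrite -natr1; ring.
apply: le_lt_trans (ltry (kappa * (j.+1%:R * v))).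
by rewrite -(@lebesgue_tball p) ?mulr_ge0.
Qed.

End shells.

(** * Chains with nonincreasing steps *)

Section euclidean_norm.
Variables (R : realType) (d : nat).
Implicit Types x y : 'rV[R]_d.

Lemma enorm_ge0 x : 0 <= enorm x.
Proof. exact: sqrtr_ge0. Qed.

Lemma sqr_enorm x : enorm x ^+ 2 = \sum_i x ord0 i ^+ 2.
Proof. by rewrite sqr_sqrtr// sumr_ge0// => i _; exact: sqr_ge0. Qed.

Lemma enormZ (a : R) x : enorm (a *: x) = `|a| * enorm x.
Proof.
rewrite /enorm -sqrtr_sqr -sqrtrM ?sqr_ge0// mulr_sumr.
by congr Num.sqrt; apply: eq_bigr => i _; rewrite mxE exprMn.
Qed.

Lemma enormN x : enorm (- x) = enorm x.
Proof. by rewrite -scaleN1r enormZ normrN1 mul1r. Qed.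

Lemma enorm_distC x y : enorm (x - y) = enorm (y - x).
Proof. by rewrite -enormN opprB. Qed.

Lemma enorm0 : enorm (0 : 'rV[R]_d) = 0.
Proof. by rewrite -(scale0r 0) enormZ normr0 mul0r. Qed.

Lemma coord_le_enorm x i : `|x ord0 i| <= enorm x.
Proof.
rewrite -sqrtr_sqr ler_wsqrtr// (bigD1 i)//= lerDl.
by apply: sumr_ge0 => j _; exact: sqr_ge0.
Qed.

Lemma enorm_eq0 x : enorm x = 0 -> x = 0.
Proof.
move=> x0; apply/rowP => i; apply/eqP; rewrite mxE -normr_le0.
by rewrite -x0 coord_le_enorm.
Qed.

Lemma Cauchy_Schwarz_enorm x y : \sum_i x ord0 i * y ord0 i <= enorm x * enorm y.
Proof.
have [x0|x0] := eqVneq (enorm x) 0.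
  rewrite x0 mul0r big1// => i _.
  by rewrite (enorm_eq0 x0) mxE mul0r.
have [y0|y0] := eqVneq (enorm y) 0.
  rewrite y0 mulr0 big1// => i _.
  by rewrite (enorm_eq0 y0) mxE mulr0.
have A0 : 0 < enorm x by rewrite lt_def x0 enorm_ge0.
have B0 : 0 < enorm y by rewrite lt_def y0 enorm_ge0.
(* Expanded, this sum of squares is 2 |x| |y| times the difference of the two sides of the claim. *)
have : 0 <= \sum_i (enorm y * x ord0 i - enorm x * y ord0 i) ^+ 2.
  by apply: sumr_ge0 => i _; exact: sqr_ge0.
rewrite (_ : \sum_i _ = enorm y ^+ 2 * \sum_i x ord0 i ^+ 2 +
    enorm x ^+ 2 * (\sum_i y ord0 i ^+ 2) -
    (2 * enorm x * enorm y) * \sum_i x ord0 i * y ord0 i); last first.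
  rewrite !mulr_sumr -big_split -sumrB /=.
  by apply: eq_bigr => i _; ring.
rewrite -!sqr_enorm subr_ge0.
have -> : enorm y ^+ 2 * enorm x ^+ 2 + enorm x ^+ 2 * enorm y ^+ 2 =
  (2 * enorm x * enorm y) * (enorm x * enorm y) by ring.
by rewrite ler_pM2l// !mulr_gt0.
Qed.

Lemma ler_enormD x y : enorm (x + y) <= enorm x + enorm y.
Proof.
rewrite -(@ler_pXn2r _ 2)// ?nnegrE ?addr_ge0 ?enorm_ge0//.
rewrite sqrrD !sqr_enorm -addrA addrCA addrC.
have -> : \sum_i (x + y) ord0 i ^+ 2 = \sum_i x ord0 i ^+ 2 + \sum_i y ord0 i ^+ 2
    + (\sum_i x ord0 i * y ord0 i) *+ 2.
  by rewrite -sumrMnl -!big_split /=; apply: eq_bigr => i _; rewrite mxE; ring.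
have := Cauchy_Schwarz_enorm x y; lra.
Qed.

Lemma ler_enorm_dist x y z : enorm (x - z) <= enorm (x - y) + enorm (y - z).
Proof. by rewrite (le_trans _ (ler_enormD _ _))// addrA subrK. Qed.

End euclidean_norm.

Section walks.
Variables (R : realType) (d : nat) (phi : set 'rV[R]_d).
Local Notation Rd := 'rV[R]_d.

(** The preferences of a descending chain are remembered only through its step lengths, since these
    behave well when loops are cut out. *)
Definition walk (s : R) m (c : nat -> Rd) := [/\ (2 <= m)%N, c 1%N = 0,
  forall i, (1 <= i <= m)%N -> if odd i then lattice (c i) else phi (c i),
  forall i, (2 <= i < m)%N -> enorm (c i.+1 - c i) <= enorm (c i - c i.-1) &
  enorm (c 2 - c 1%N) <= s].

Lemma walk_step_nincr s m c i j : walk s m c -> (1 <= i <= j)%N -> (j < m)%N ->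
  enorm (c j.+1 - c j) <= enorm (c i.+1 - c i).
Proof.
move=> [_ _ _ mono _]; elim: j => [|j IHj]; first by case: i.
move=> /andP[i1]; rewrite leq_eqVlt => /predU1P[->//|].
rewrite ltnS => ij jm; apply: le_trans (IHj _ (ltnW jm)); last by rewrite i1.
by apply: (mono j.+1); lia.
Qed.

Lemma walk_step s m c i : walk s m c -> (1 <= i < m)%N ->
  enorm (c i.+1 - c i) <= s.
Proof.
move=> W /andP[i1 im]; have [_ _ _ _] := W; apply: le_trans.
by apply: (walk_step_nincr W) => //; rewrite i1.
Qed.

Lemma walk_dist s m c i : walk s m c -> (i < m)%N -> enorm (c i.+1) <= s *+ i.
Proof.
move=> W; elim: i => [_|i IHi im].
  by have [_ -> _ _ _] := W; rewrite enorm0.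
rewrite mulrSr -[c i.+2](subrK (c i.+1)) (le_trans (ler_enormD _ _))// addrC.
by rewrite lerD ?IHi ?(walk_step W)// ltnW.
Qed.

(* Excising the closed loop between two visits of the same point keeps the step
   lengths nonincreasing, although it may break the preferences of the chain. *)
Lemma walk_excise s m c i j : walk s m c -> (0 < i < j)%N -> (j.*2 <= m)%N ->
  c i.*2 = c j.*2 ->
  let k := (j - i).*2 in
  walk s (m - k) (fun l => if (l <= i.*2)%N then c l else c (l + k)%N).
Proof.
move=> W /andP[i0 ij] jm cij k; have [m2 c1 mem mono st] := W.
set f := fun l => _; have km : (i.*2 + k = j.*2)%N by rewrite /k; lia.
have fl l : (l <= i.*2)%N -> f l = c l by rewrite /f => ->.
have fg l : (i.*2 <= l)%N -> f l = c (l + k)%N.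
  rewrite leq_eqVlt => /predU1P[<-|il]; first by rewrite fl// km.
  by rewrite /f leqNgt il.
clearbody f; split; rewrite ?fl//; try lia.
- move=> l /andP[l1 lm]; case: (leqP l i.*2) => li.
    by rewrite fl//; apply: mem; lia.
  rewrite fg; last exact: ltnW.
  have := mem (l + k)%N; rewrite oddD odd_double addbF; apply; lia.
- move=> l /andP[l2 lm]; case: (ltngtP l i.*2) => li.
  + by rewrite !fl; try lia; apply: mono; lia.
  + rewrite !fg; try lia.
    have := mono (l + k)%N; rewrite (_ : (l + k).-1 = (l.-1 + k)%N); last lia.
    by rewrite addSn; apply; lia.
  + rewrite (fg l.+1) ?(fl l) ?(fl l.-1); try lia.
    rewrite li cij addSn km -[X in _ <= enorm (X - _)]cij.
    have := @walk_step_nincr _ _ _ i.*2.-1 j.*2 W.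
    by rewrite prednK; [apply; lia|lia].
Qed.

(** The endpoint survives the excision. If the loop closes the walk, then m = 2j and the new last
    index m - k is 2i, where the walk has the same value. *)
Lemma walk_last_excise s m c i j : walk s m c -> (0 < i < j)%N -> (j.*2 <= m)%N ->
  c i.*2 = c j.*2 ->
  let k := (j - i).*2 in
  (if (m - k <= i.*2)%N then c (m - k)%N else c (m - k + k)%N) = c m.
Proof.
move=> W /andP[i0 ij] jm cij k; case: ifP => h.
  have -> : m = j.*2 by rewrite /k in h; lia.
  by rewrite -cij; congr c; rewrite /k; lia.
by congr c; rewrite /k; lia.
Qed.

(** Strong induction on the length: each excision shortens the walk and keeps its endpoint. *)
Lemma walk_simple s m c : walk s m c -> exists m' c',
  [/\ walk s m' c', c' m' = c m &
      forall i j, (0 < i)%N -> (i < j)%N -> (j.*2 <= m')%N -> c' i.*2 <> c' j.*2].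
Proof.
elim/ltn_ind: m c => m IHm c W.
have [S|] := pselect (forall i j, (0 < i)%N -> (i < j)%N -> (j.*2 <= m)%N ->
  c i.*2 <> c j.*2); first by exists m, c.
move=> /existsNP[i /existsNP[j /not_implyP[i0 /not_implyP[ij /not_implyP[jm]]]]].
move=> /contrapT cij; have ij' : (0 < i < j)%N by rewrite i0.
have km : (m - (j - i).*2 < m)%N by lia.
have [m' [c' [W' cm' S']]] := IHm _ km _ (walk_excise W ij' jm cij).
exists m', c'; split => //; rewrite cm'.
exact: walk_last_excise W ij' jm cij.
Qed.

(** A point of the flower outside the ball of radius [r] lies within one step length, hence within
    [s], of some chain point; the chain is cut off at that point. *)
Lemma far_flower_walk t (s r : R) : s <= r -> enorm t <= s ->
  tau lattice phi 0 = Some t -> ~ (flower lattice phi 0 `<=` cball 0 r) ->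
  exists m c, walk s m c /\ r - s < enorm (c m).
Proof.
move=> sr ts tauE; rewrite /flower tauE => /existsNP[y /not_implyP[]].
move=> [n [c [[[n2 mem pref] c1 [t' [tauE' c2t]]] cy]]].
rewrite /cball /= subr0 => /negP; rewrite -ltNge => ry.
have {t' tauE' c2t} c2s : enorm (c 2 - c 1%N) <= s.
  move: tauE'; rewrite tauE => -[tt']; rewrite c1 subr0.
  case: c2t => [->|]; first by rewrite -tt'.
  by rewrite /prefers1 !subr0 -tt' => -[/ltW|[-> _]]// => /le_trans; apply.
have W k : (2 <= k <= n)%N -> walk s k c.
  move=> /andP[k2 kn]; split => //.
    by move=> i ik; apply: mem; lia.
  move=> i ik; have := pref i ltac:(lia).
  rewrite (enorm_distC (c i)).
  by case: ifP => _ [/ltW|[-> _]]//; rewrite enorm_distC.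
(* The ball around [c 1] is centred at 0 and has radius at most s <= r, so it cannot contain [y]. *)
case: cy => [|[i /= i2n]].
  rewrite /cball /= c1 subr0 enorm_distC -c1 => y12; exfalso.
  by move: (lt_le_trans ry y12); rewrite ltNge (le_trans c2s).
rewrite /cball /= => yi; exists i, c; split; first exact: W.
have is_ : enorm (c i - c i.-1) <= s.
  have := @walk_step s i c i.-1 (W _ i2n).
  by rewrite prednK; [apply; lia|lia].
rewrite ltrBlDr (lt_le_trans ry)// -[y in leLHS](subrK (c i)) addrC.
by rewrite (le_trans (ler_enormD _ _))// lerD2l (le_trans yi).
Qed.

Lemma far_flower_tuple t (s r : R) n : 0 < s -> (0 < n)%N -> s *+ n.*2 <= r ->
  enorm t <= s ->
  tau lattice phi 0 = Some t -> ~ (flower lattice phi 0 `<=` cball 0 r) ->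
  exists x p : nat -> Rd, [/\ p 0%N = 0,
    forall k, (k < n)%N -> [/\ lattice (p k), phi (x k) & enorm (x k - p k) <= s],
    forall k l, (k < l)%N -> (l < n)%N -> x k <> x l,
    forall k l, (k <= l)%N -> (l < n)%N -> enorm (x l - p l) <= enorm (x k - p k) &
    forall k, (k.+1 < n)%N -> enorm (p k.+1 - x k) <= s].
Proof.
move=> s0 n0 snr ts tauE far.
have sr : s <= r by rewrite (le_trans _ snr)// -[leLHS]mulr1n ler_pMn2l//; lia.
have [m0 [c0 [W0 rm0]]] := far_flower_walk sr ts tauE far.
have [m [c [W cm S]]] := walk_simple W0.
(* The m - 1 steps lead farther than r - s, so 2ns <= r < ms. *)
have nm : (n.*2 <= m)%N.
  have [m2 _ _ _ _] := W.
  have := walk_dist W (_ : m.-1 < m)%N; rewrite prednK; last lia.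
  move=> /(_ ltac:(lia)); rewrite cm => /(lt_le_trans rm0).
  rewrite ltrBlDr -mulrSr prednK; last lia.
  by move=> /(le_lt_trans snr); rewrite ltr_pMn2l// => /ltnW.
have [m2 c1 mem mono st] := W.
(* Chains are indexed from 1 and start in the lattice, whereas the tuples are indexed from 0: p_k is
   z_(2k+1) and x_k is z_(2k+2). *)
exists (fun k => c k.+1.*2), (fun k => c k.*2.+1); split.
- exact: c1.
- move=> k kn; split.
  + by have := mem k.*2.+1 ltac:(lia); rewrite /= odd_double.
  + by have := mem k.+1.*2 ltac:(lia); rewrite odd_double.
  + by apply: (@walk_step _ _ _ k.*2.+1 W); lia.
- by move=> k l kl ln; apply: S; lia.
- by move=> k l kl ln; apply: (@walk_step_nincr _ _ _ k.*2.+1 l.*2.+1 W); lia.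
- by move=> k kn; apply: (@walk_step _ _ _ k.+1.*2 W); lia.
Qed.

End walks.

(** * First moment bound *)

Lemma measure_bigsetU_le d (T : measurableType d) (R : realType)
    (mu : {measure set T -> \bar R}) (I : Type) (r : seq I) (P : pred I)
    (F : I -> set T) : (forall i, measurable (F i)) ->
  (mu (\big[setU/set0]_(i <- r | P i) F i) <= \sum_(i <- r | P i) mu (F i))%E.
Proof.
move=> mF; pose Q (A : set T) (x : \bar R) := measurable A /\ (mu A <= x)%E.
suff: Q (\big[setU/set0]_(i <- r | P i) F i) (\sum_(i <- r | P i) mu (F i))%E by case.
apply: (big_ind2 Q) => [|A x B y [mA Ax] [mB By]|i _]; split => //.
- by rewrite measure0.
- exact: measurableU.
- by rewrite (le_trans (measureU2 _ _ _))// leeD.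
Qed.

Section first_moment.
Import HBNNSimple.
Variables (R : realType) (d : nat) (dO : measure_display)
  (Omega : measurableType dO) (P : probability Omega R)
  (Psi : {RV P >-> configuration R d}).

(** On [E] the sum over distinct tuples is at least 1, by the single term [x]. The indicator of [E]
    is thus a simple function below the integrand, and the integral is a supremum over such
    functions; no measurability of the integrand enters. *)
Lemma probability_le_factorial_moment n (A : set 'M[R]_(n, d)) (E : set Omega) :
  measurable E ->
  (forall w, E w -> exists2 x, distinct_tuples (Psi w) x & A x) ->
  (P E <= factorial_moment_measure Psi A)%E.
Proof.
move=> mE EA; rewrite /factorial_moment_measure ge0_integralE; last first.
  by move=> w _; apply: esum_ge0.
apply: ereal_sup_ubound => /=; exists (indic_nnsfun R mE); last first.
  exact: sintegral_indic.
move=> w; rewrite patch_setT (_ : indic_nnsfun R mE w = \1_E w)// indicE; have [|_] := boolP (w \in E); last first.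
  by rewrite esum_ge0.
rewrite inE => /EA[x xPsi Ax]; apply: esum_ge; exists [set x].
  by split; [exact: finite_set1|move=> _ ->].
by rewrite fsbig_set1 diracE mem_set.
Qed.

Lemma factorial_moment_le n (A : set 'M[R]_(n, d)) (rho : 'M[R]_(n, d) -> \bar R) M :
  is_correlation_function Psi rho -> 0 <= M -> (forall x, (rho x <= M%:E)%E) ->
  measurable A ->
  (factorial_moment_measure Psi A <= M%:E * lebesgue_mx R n d A)%E.
Proof.
move=> [mrho rho0 rhoE] M0 rhoM mA; rewrite rhoE//.
rewrite -integral_cst//; apply: ge0_le_integral => //.
exact: measurable_funS mrho.
Qed.

End first_moment.

Section lattice_paths.
Variables (R : realType) (d n K : nat).
Local Notation increments := {ffun 'I_n * 'I_d -> 'I_K.*2.+1}.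

(* An increment [z] in [-K, K] is encoded as [z + K]. *)
Definition center (e : increments) (k j : nat) : R :=
  \sum_(l < n | (l < k)%N) oapp (fun j' => (e (l, j'))%:R - K%:R) 0 (insub j).

Lemma centerS e (l : 'I_n) (j : 'I_d) :
  center e l.+1 j = center e l j + ((e (l, j))%:R - K%:R).
Proof.
rewrite /center valK /= (bigD1 l)//= addrC; congr (_ + _).
by apply: eq_bigl => i; rewrite ltnS ltn_neqAle andbC -(inj_eq val_inj).
Qed.

(** The coordinates of an increment are integers of absolute value below K + 1, hence at most K, so
    the encoding loses nothing and the partial sums telescope from p_0 = 0. *)
Lemma lattice_path_center (p : nat -> 'rV[R]_d) : p 0%N = 0 ->
  (forall k, (k < n)%N -> lattice (p k)) ->
  (forall k, (k.+1 < n)%N -> enorm (p k.+1 - p k) < K.+1%:R) ->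
  exists e, forall k (j : 'I_d), (k < n)%N -> center e k j = p k ord0 j.
Proof.
move=> p0 pL pK.
exists [ffun lj : 'I_n * 'I_d => inord (Num.truncn (p lj.1.+1 ord0 lj.2 - p lj.1 ord0 lj.2 + K%:R))].
move=> k j; elim: k => [_|k IHk kn].
  by rewrite /center big_pred0 ?p0 ?mxE.
have kn' := ltnW kn.
rewrite (centerS _ (Ordinal kn')) IHk// ffunE /=.
have [a aE] := intrP (pL _ kn j); have [b bE] := intrP (pL _ kn' j).
have := coord_le_enorm (p k.+1 - p k) j; rewrite !mxE aE bE => /le_lt_trans.
move=> /(_ _ (pK _ kn)); rewrite [K.+1%:R]pmulrn -rmorphB /= -intr_norm ltr_int => abK.
have -> : ((a - b)%:~R + K%:R : R) = (absz (a - b + K%:Z))%:R.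
  by rewrite !pmulrn -rmorphD /=; congr (_%:~R); lia.
rewrite natrK inordK; last by lia.
by rewrite !pmulrn -rmorphB -rmorphD /=; congr (_%:~R); lia.
Qed.

End lattice_paths.

Section chain_probability.
Variables (R : realType) (d : nat) (dO : measure_display)
  (Omega : measurableType dO) (P : probability Omega R)
  (Psi : {RV P >-> configuration R d}).
Hypothesis d0 : (0 < d)%N.
Variables (n K : nat) (s M : R) (rho : 'M[R]_(n, d) -> \bar R).
Hypotheses (n0 : (0 < n)%N) (s0 : 0 < s) (sK : s + s < K.+1%:R) (M0 : 0 <= M).
Hypotheses (rhoP : is_correlation_function Psi rho)
  (rhoM : forall x, (rho x <= M%:E)%E).

Let v : R := s ^+ d / n%:R.

Let v0 : 0 < v. Proof. by rewrite divr_gt0// ?exprn_gt0// ltr0n. Qed.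

(** There are n + 1 shell numbers rather than n: a point at distance exactly [s] lies in shell n. *)
Let index := ({ffun 'I_n * 'I_d -> 'I_K.*2.+1} * n.-tuple 'I_n.+1)%type.

Let cell_shell (i : index) (k : 'I_n) :=
  @shell R d (center R i.1 k) v (rev_ord (tnth i.2 k)).

(* [i.1] encodes the increments p_(k+1) - p_k. The shell numbers decrease along the
   chain; [rev_ord] makes [i.2] nondecreasing, for [card_sorted_tuples]. *)
Definition chain_cell (i : index) : set 'M[R]_(n, d) :=
  [set x | forall k : 'I_n, cell_shell i k (row_tuple x k)].

Lemma measurable_chain_cell i : measurable (chain_cell i).
Proof. exact: (measurable_rows (fun k => measurable_shell _ _ _)). Qed.

Lemma lebesgue_chain_cell i :
  lebesgue_mx R n d (chain_cell i) = ((kappa R d * v) ^+ n)%:E.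
Proof.
rewrite [LHS](lebesgue_mx_rows (fun k => measurable_shell _ _ _)).
under eq_bigr do rewrite lebesgue_shell ?ltW//.
by rewrite prodEFin prodr_const card_ord.
Qed.

Definition chain_set : set 'M[R]_(n, d) :=
  \big[setU/set0]_(i : index | sorted leq (map val i.2)) chain_cell i.

Lemma measurable_chain_set : measurable chain_set.
Proof. by apply: bigsetU_measurable => i _; exact: measurable_chain_cell. Qed.

(** All cells have the same measure; there are [K.*2.+1 ^ (n * d)] families of increments and
    ['C(n + n, n)] nondecreasing n-tuples of shell numbers. *)
Lemma lebesgue_chain_set : (lebesgue_mx R n d chain_set <=
  ((kappa R d * v) ^+ n *+ (K.*2.+1 ^ (n * d) * 'C(n + n, n)))%:E)%E.
Proof.
apply: le_trans (measure_bigsetU_le _ _ _ measurable_chain_cell) _.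
apply: (@le_trans _ _ (\sum_(i : index | sorted leq (map val i.2))
    ((kappa R d * v) ^+ n)%:E)%E).
  by apply: lee_sum => i _; rewrite [leLHS](lebesgue_chain_cell i).
rewrite sumEFin lee_fin.
rewrite -(pair_big xpredT (fun t : n.-tuple 'I_n.+1 => sorted leq (map val t))
  (fun _ _ => (kappa R d * v) ^+ n)) /=.
rewrite !sumr_const -mulrnA mulnC card_ffun card_prod !card_ord.
by rewrite -card_sorted_tuples cardsE.
Qed.

Lemma mem_chain_set (x : 'M[R]_(n, d)) (p : nat -> 'rV[R]_d) : p 0%N = 0 ->
  (forall k, (k < n)%N -> lattice (p k)) ->
  (forall k : 'I_n, enorm (row k x - p k) <= s) ->
  (forall k l : 'I_n, (k <= l)%N -> enorm (row l x - p l) <= enorm (row k x - p k)) ->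
  (forall k : 'I_n, (k.+1 < n)%N -> enorm (p k.+1 - row k x) <= s) ->
  chain_set x.
Proof.
move=> p0 pL xs xmono ps.
(* Passing through x_k, consecutive lattice points are at distance at most 2s < K + 1. *)
have [|e eE] := @lattice_path_center R d n K p p0 pL.
  move=> k kn; apply: le_lt_trans sK; pose k' := Ordinal (ltnW kn).
  by rewrite (le_trans (ler_enorm_dist _ (row k' x) _))// lerD// ?(ps k')// (xs k').
have tnE k : tnorm (row_tuple x k) (center R e k) = enorm (row k x - p k).
  congr Num.sqrt; apply: eq_bigr => j _.
  by rewrite tnth_mktuple eE ?ltn_ord// !mxE.
(* The integer part of [u k] is the number of the shell around p_k that contains x_k. *)
pose u (k : 'I_n) := enorm (row k x - p k) ^+ d / v.
have u0 k : 0 <= u k by rewrite divr_ge0 ?exprn_ge0 ?enorm_ge0// ltW.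
have un k : (Num.truncn (u k) < n.+1)%N.
  rewrite truncn_lt_nat// /u ltr_pdivrMr//.
  apply: (@le_lt_trans _ _ (n%:R * v)); last by rewrite ltr_pM2r// ltr_nat.
  rewrite /v mulrC divfK ?pnatr_eq0 -?lt0n//.
  by rewrite lerXn2r// ?nnegrE ?enorm_ge0// ltW.
pose t := [tuple rev_ord (inord (Num.truncn (u k)) : 'I_n.+1) | k < n].
rewrite /chain_set (bigD1 (e, t))//=; last first.
  apply/(sortedP 0%N) => i; rewrite size_map size_tuple card_ord => i1n.
  have i0n := ltnW i1n.
  have E (k : 'I_n) : nth 0%N (map val t) k = (n - Num.truncn (u k))%N.
    rewrite (nth_map ord0) ?size_tuple// -tnth_nth tnth_mktuple /= inordK//.
  rewrite (E (Ordinal i0n)) (E (Ordinal i1n)) leq_sub2l//.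
  apply: le_truncn; rewrite ler_pM2r ?invr_gt0// lerXn2r ?nnegrE ?enorm_ge0//.
  exact: xmono.
left => k; rewrite /cell_shell (_ : rev_ord (tnth _ k) = inord (Num.truncn (u k))).
  rewrite /shell /= tnE inordK//; have := truncn_itv (u0 k).
  by rewrite /u ler_pdivlMr// ltr_pdivrMr.
by rewrite tnth_mktuple rev_ordK.
Qed.

Lemma chain_probability_le (E : set Omega) : measurable E ->
  (forall w, E w -> exists x p : nat -> 'rV[R]_d, [/\ p 0%N = 0,
    forall k, (k < n)%N -> [/\ lattice (p k), points (Psi w) (x k) & enorm (x k - p k) <= s],
    forall k l, (k < l)%N -> (l < n)%N -> x k <> x l,
    forall k l, (k <= l)%N -> (l < n)%N -> enorm (x l - p l) <= enorm (x k - p k) &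
    forall k, (k.+1 < n)%N -> enorm (p k.+1 - x k) <= s]) ->
  (P E <= (M * ((kappa R d * v) ^+ n *+ (K.*2.+1 ^ (n * d) * 'C(n + n, n))))%:E)%E.
Proof.
move=> mE EA.
apply: (@le_trans _ _ (M%:E * lebesgue_mx R n d chain_set)%E); last first.
  by rewrite EFinM lee_wpmul2l ?lee_fin// lebesgue_chain_set.
apply: le_trans (factorial_moment_le rhoP M0 rhoM measurable_chain_set).
apply: probability_le_factorial_moment => // w /EA[x [p [p0 xp xinj xmono ps]]].
pose X := \matrix_(k < n) x k.
have rX (k : 'I_n) : row k X = x k by rewrite rowK.
exists X.
  split; last by move=> k; rewrite rX; case: (xp k (ltn_ord k)).
  move=> k l; rewrite !rX => xkl; apply/val_inj.
  case: (ltngtP k l) => // kl.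
    by exfalso; apply: (xinj k l).
  by exfalso; apply: (xinj l k).
apply: (@mem_chain_set X p) => // [k kn|k|k l kl|k kn]; rewrite ?rX.
- by case: (xp k kn).
- by case: (xp k (ltn_ord k)).
- exact: xmono.
- exact: ps.
Qed.

End chain_probability.

(** * Measurability *)

Section measurable_predicates.
Context disp (T : measurableType disp).
Implicit Types Q : T -> Prop.

(** These closure rules let a measurability proof follow the formula that defines the event, as long
    as its quantifiers are countable. *)
Lemma measurable_pand Q1 Q2 : measurable [set w | Q1 w] ->
  measurable [set w | Q2 w] -> measurable [set w | Q1 w /\ Q2 w].
Proof. exact: measurableI. Qed.

Lemma measurable_por Q1 Q2 : measurable [set w | Q1 w] ->
  measurable [set w | Q2 w] -> measurable [set w | Q1 w \/ Q2 w].
Proof. exact: measurableU. Qed.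

Lemma measurable_pnot Q : measurable [set w | Q w] -> measurable [set w | ~ Q w].
Proof. exact: measurableC. Qed.

Lemma measurable_pimply Q1 Q2 : measurable [set w | Q1 w] ->
  measurable [set w | Q2 w] -> measurable [set w | Q1 w -> Q2 w].
Proof.
move=> m1 m2; rewrite (_ : [set _ | _] = [set w | ~ Q1 w \/ Q2 w]).
  exact: measurable_por (measurable_pnot m1) m2.
apply/funext => w; apply/propext; split => [h|[nq|q] //].
by have [/h|] := pselect (Q1 w); [right|left].
Qed.

Lemma measurable_pcst (q : Prop) : measurable [set _ : T | q].
Proof.
have [h|h] := pselect q.
  by rewrite (_ : [set _ | _] = setT)//; apply/seteqP; split.
by rewrite (_ : [set _ | _] = set0)//; apply/seteqP; split.
Qed.

Lemma measurable_pex (I : countType) (Q : I -> T -> Prop) :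
  (forall i, measurable [set w | Q i w]) -> measurable [set w | exists i, Q i w].
Proof.
move=> mQ; rewrite (_ : [set _ | _] = \bigcup_(i in setT) [set w | Q i w]).
  by apply: countable_bigcupT_measurable => //; exact: countableP.
by apply/seteqP; split => w [i]; [exists i|move=> _ ?; exists i].
Qed.

Lemma measurable_pall (I : countType) (Q : I -> T -> Prop) :
  (forall i, measurable [set w | Q i w]) -> measurable [set w | forall i, Q i w].
Proof.
move=> mQ; rewrite (_ : [set _ | _] = [set w | ~ exists i, ~ Q i w]).
  by apply/measurable_pnot/measurable_pex => i; exact: measurable_pnot.
by apply/funext => w; apply/propext; split => [h [i]|/forallNP h i]; [exact|exact: contrapT].
Qed.

Context (R : realType).
Implicit Types f g : T -> R.

Lemma measurable_plt f g : measurable_fun setT f -> measurable_fun setT g ->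
  measurable [set w | f w < g w].
Proof.
move=> mf mg; have := measurable_fun_ltr mf mg measurableT (_ : measurable [set true]).
by rewrite setTI; apply.
Qed.

Lemma measurable_ple f g : measurable_fun setT f -> measurable_fun setT g ->
  measurable [set w | f w <= g w].
Proof.
move=> mf mg; have := measurable_fun_ler mf mg measurableT (_ : measurable [set true]).
by rewrite setTI; apply.
Qed.

Lemma measurable_peq f g : measurable_fun setT f -> measurable_fun setT g ->
  measurable [set w | f w = g w].
Proof.
move=> mf mg; rewrite (_ : [set _ | _] = [set w | f w <= g w /\ g w <= f w]).
  by apply: measurable_pand; exact: measurable_ple.
apply/funext => w; apply/propext; split => [/= ->//|[h1 h2]].
by apply/eqP; rewrite eq_le h1 h2.
Qed.

End measurable_predicates.

Section measurable_points.
Context disp (T : measurableType disp) (R : realType) (d : nat).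
Implicit Types f g p : T -> 'rV[R]_d.

Lemma measurable_coord_comp f i : measurable_fun setT f ->
  measurable_fun setT (fun w => f w ord0 i).
Proof. exact: measurableT_comp (measurable_coord _ _). Qed.

Lemma measurable_enorm f : measurable_fun setT f ->
  measurable_fun setT (fun w => enorm (f w)).
Proof.
move=> mf; apply: (measurableT_comp (@measurable_sqrt R)).
by apply: measurable_sum => i; apply: measurable_funX; exact: measurable_coord_comp.
Qed.

Lemma measurable_enormB f g : measurable_fun setT f -> measurable_fun setT g ->
  measurable_fun setT (fun w => enorm (f w - g w)).
Proof.
move=> mf mg; apply: (measurableT_comp (@measurable_sqrt R)).
apply: measurable_sum => i; apply: measurable_funX.
under eq_fun do rewrite !mxE.
by apply: measurable_funB; exact: measurable_coord_comp.
Qed.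

Lemma measurable_peq_rV f g : measurable_fun setT f -> measurable_fun setT g ->
  measurable [set w | f w = g w].
Proof.
move=> mf mg; rewrite (_ : [set _ | _] = [set w | forall i, f w ord0 i = g w ord0 i]).
  by apply: measurable_pall => i; apply: measurable_peq; exact: measurable_coord_comp.
by apply/funext => w; apply/propext; split => [/= ->//|h]; exact/rowP.
Qed.

Lemma measurable_lex_lt f g : measurable_fun setT f -> measurable_fun setT g ->
  measurable [set w | lex_lt (f w) (g w)].
Proof.
move=> mf mg; apply: measurable_pex => i; apply: measurable_pand.
  by apply: measurable_plt; exact: measurable_coord_comp.
apply: measurable_pall => j; apply: measurable_pimply; first exact: measurable_pcst.
by apply: measurable_peq; exact: measurable_coord_comp.
Qed.

Lemma measurable_prefers1 p f g : measurable_fun setT p -> measurable_fun setT f ->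
  measurable_fun setT g -> measurable [set w | prefers1 (p w) (f w) (g w)].
Proof.
move=> mp mf mg; apply: measurable_por.
  by apply: measurable_plt; exact: measurable_enormB.
apply: measurable_pand; last exact: measurable_lex_lt.
by apply: measurable_peq; exact: measurable_enormB.
Qed.

Lemma measurable_prefers2 p f g : measurable_fun setT p -> measurable_fun setT f ->
  measurable_fun setT g -> measurable [set w | prefers2 (p w) (f w) (g w)].
Proof.
move=> mp mf mg; apply: measurable_por.
  by apply: measurable_plt; exact: measurable_enormB.
apply: measurable_pand; last exact: measurable_lex_lt.
by apply: measurable_peq; exact: measurable_enormB.
Qed.

End measurable_points.

Lemma counting_eq1 (T : choiceType) (R : realType) (A : set T) :
  counting A = 1%E :> \bar R <-> exists x, A = [set x].
Proof.
rewrite /counting; split; last first.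
  move=> [x ->]; have fx : finite_set [set x] by exact: finite_set1.
  by rewrite asboolT// fset_set1 finmap.cardfs1.
case: ifPn => // /asboolP fA [] /eqP; rewrite pnatr_eq1 => /eqP/eqP.
move=> /finmap.cardfs1P[x Ax]; exists x.
rewrite -(fset_setK fA) Ax; apply/seteqP.
by split => y /=; rewrite finmap.in_fset1 => /eqP.
Qed.

Section enumeration.
Variables (R : realType) (d : nat).
Local Notation Rd := 'rV[R]_d.
Local Notation conf := (configuration R d).
Implicit Types phi : conf.

Lemma measurable_count1 (B : set Rd) : measurable B ->
  measurable [set phi : conf | point_count B phi = 1%E].
Proof.
move=> mB; apply: sub_sigma_algebra; exists B => //.
by exists [set 1%E] => //; rewrite setTI.
Qed.

Local Notation I := ('rV[rat]_d * nat)%type.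

Definition cell (i : I) : set Rd := ball (map_mx ratr i.1 : Rd) (i.2.+1%:R^-1 : R).

Lemma measurable_cell i : measurable (cell i).
Proof. by apply: sub_sigma_algebra; exact: ball_open. Qed.

Definition isolating (i : I) phi := point_count (cell i) phi = 1%E.

(* Junk value 0 when the ball does not isolate a point. *)
Definition pt (i : I) phi : Rd :=
  if pselect (isolating i phi) then xget 0 (points phi `&` cell i) else 0.

Lemma ptE i phi x : points phi `&` cell i = [set x] -> pt i phi = x.
Proof.
move=> E; rewrite /pt; case: pselect => /= [iso|[]]; last by apply/counting_eq1; exists x.
by rewrite E; apply: xget_unique => // y ->.
Qed.

(** By local finiteness some ball around [x] contains no other point of [phi]. A rational ball that
    contains [x] and has less than half that radius stays inside it. *)
Lemma pt_surj phi x : points phi x -> exists i, isolating i phi /\ pt i phi = x.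
Proof.
move=> phix.
have finG : finite_set ((points phi `&` ball x 1) `\` [set x]).
  apply: finite_setD; apply: points_locally_finite.
  exists (`|x| + 1); split; first exact: num_real.
  move=> M xM y; rewrite -ball_normE /= => xy; apply: le_trans (ltW xM).
  rewrite -[y](subrK x) addrC (le_trans (ler_normD _ _))// lerD2l.
  by rewrite distrC ltW.
have : nbhs x (~` ((points phi `&` ball x 1) `\` [set x])).
  apply: open_nbhs_nbhs; split; last by move=> [_]; apply.
  apply: closed_openC; move: finG; apply: accessible_finite_set_closed.1.
  exact/hausdorff_accessible/norm_hausdorff.
move=> /nbhs_ballP[e /= e0 eG].
(* The radius is capped at 1 because [eG] only excludes the other points in the unit ball around
   [x]. *)
pose e' := Num.min e 1; have e'0 : 0 < e' by rewrite lt_min e0 ltr01.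
pose k := Num.truncn (e' / 2)^-1.
have ke : k.+1%:R^-1 < e' / 2 :> R.
  by rewrite invf_plt ?posrE ?divr_gt0// truncnS_gt.
have k0 : 0 < k.+1%:R^-1 :> R by rewrite invr_gt0.
have /fin_all_exists[q xq] (j : 'I_d) : exists p : rat,
    ball (x ord0 j) (k.+1%:R^-1 : R) (ratr p).
  have [p pA] := @rat_in_itvoo R (x ord0 j - k.+1%:R^-1)
    (x ord0 j + k.+1%:R^-1) ltac:(by rewrite ltrBlDr -addrA ltrDl addr_gt0).
  by exists p; rewrite ball_itv.
pose i : I := (\row_j q j, k).
have xi : cell i x.
  by split => // a j; rewrite ord1 !mxE; exact/ball_sym/xq.
have iE : points phi `&` cell i = [set x].
  apply/seteqP; split => [y [phiy iy]|_ ->//].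
  have xy : ball x e' y.
    rewrite (splitr e').
    exact: ball_triangle (le_ball (ltW ke) (ball_sym xi)) (le_ball (ltW ke) iy).
  apply: contrapT => yx; apply: (eG y).
    by apply: le_ball xy; rewrite /e' ge_min lexx.
  by split => //; split => //; apply: le_ball xy; rewrite /e' ge_min lexx orbT.
exists i; split; last exact: ptE.
by apply/counting_eq1; exists x.
Qed.

(** If the cell isolates a point, then this point lies in [B] exactly when the cell intersected with
    [B] still has count 1. *)
Lemma measurable_pt i : measurable_fun setT (pt i).
Proof.
move=> _ B mB; rewrite setTI.
rewrite (_ : _ @^-1` _ = [set phi | (isolating i phi /\
   point_count (cell i `&` B) phi = 1%E) \/ (~ isolating i phi /\ B 0)]).
  apply: measurable_por; apply: measurable_pand.
  - exact: measurable_count1 (measurable_cell i).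
  - exact: measurable_count1 (measurableI _ _ (measurable_cell i) mB).
  - exact: measurable_pnot (measurable_count1 (measurable_cell i)).
  - exact: measurable_pcst.
apply/funext => phi; apply/propext => /=.
have [iso|niso] := pselect (isolating i phi); last first.
  rewrite /pt; case: pselect => //= niso'; split; first by right.
  by case=> [[]|[]].
have [x E] := (counting_eq1 R _).1 iso; rewrite (ptE E).
split => [Bx|[[_ /counting_eq1[y]]|[]]//].
  left; split => //; apply/counting_eq1; exists x.
  by rewrite setIA E; apply/seteqP; split => [z []//|z /= ->].
by rewrite setIA E => /seteqP[_ /(_ y erefl)[]] /= ->.
Qed.

End enumeration.

(** * Uniqueness of partners in the matching *)

Section preferences.
Variables (R : realType) (d : nat).
Implicit Types (phi psi : set 'rV[R]_d) (p q x y z : 'rV[R]_d).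

Lemma lex_lt_asym x y : lex_lt x y -> ~ lex_lt y x.
Proof.
move=> [i [xyi ei]] [j [yxj ej]].
case: (ltngtP i j) => ij.
- by move: xyi; rewrite (ej _ ij) ltxx.
- by move: yxj; rewrite (ei _ ij) ltxx.
- by move: yxj xyi; rewrite (val_inj ij) => /lt_trans /[apply]; rewrite ltxx.
Qed.

Lemma prefers1_asym p x y : prefers1 p x y -> ~ prefers1 p y x.
Proof.
move=> [h|[e h]] [h'|[e' h']].
- by move: (lt_trans h h'); rewrite ltxx.
- by move: h; rewrite e' ltxx.
- by move: h'; rewrite e ltxx.
- exact: lex_lt_asym h h'.
Qed.

Lemma prefers2_asym x p q : prefers2 x p q -> ~ prefers2 x q p.
Proof.
move=> [h|[e h]] [h'|[e' h']].
- by move: (lt_trans h h'); rewrite ltxx.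
- by move: h; rewrite e' ltxx.
- by move: h'; rewrite e ltxx.
- exact: lex_lt_asym h h'.
Qed.

Lemma mutual_nearest_inj1 phi psi p x y :
  mutual_nearest phi psi p x -> mutual_nearest phi psi p y -> x = y.
Proof.
move=> [_ psix xn _] [_ psiy yn _]; apply: contrapT => xy.
by apply: (@prefers1_asym p x y); [apply: xn => // /esym|exact: yn].
Qed.

Lemma mutual_nearest_inj2 phi psi p q x :
  mutual_nearest phi psi p x -> mutual_nearest phi psi q x -> p = q.
Proof.
move=> [phip _ _ pn] [phiq _ _ qn]; apply: contrapT => pq.
by apply: (@prefers2_asym x p q); [apply: pn => // /esym|exact: qn].
Qed.

Lemma unmatchedS1 phi psi n p : (unmatched phi psi n.+1).1 p <->
  (unmatched phi psi n).1 p /\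
  ~ exists x, mutual_nearest (unmatched phi psi n).1 (unmatched phi psi n).2 p x.
Proof. by rewrite /=; case: unmatched. Qed.

Lemma unmatchedS2 phi psi n x : (unmatched phi psi n.+1).2 x <->
  (unmatched phi psi n).2 x /\
  ~ exists p, mutual_nearest (unmatched phi psi n).1 (unmatched phi psi n).2 p x.
Proof. by rewrite /=; case: unmatched. Qed.

Lemma unmatched_sub1 phi psi m n : (m <= n)%N ->
  (unmatched phi psi n).1 `<=` (unmatched phi psi m).1.
Proof.
elim: n => [|n IHn]; first by rewrite leqn0 => /eqP-> p.
rewrite leq_eqVlt => /predU1P[-> p //|mn] p /unmatchedS1[h _].
exact: IHn.
Qed.

Lemma unmatched_sub2 phi psi m n : (m <= n)%N ->
  (unmatched phi psi n).2 `<=` (unmatched phi psi m).2.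
Proof.
elim: n => [|n IHn]; first by rewrite leqn0 => /eqP-> p.
rewrite leq_eqVlt => /predU1P[-> p //|mn] p /unmatchedS2[h _].
exact: IHn.
Qed.

Lemma matched2 phi psi p x : matched phi psi p x -> psi x.
Proof. by move=> [n [_ + _ _]]; exact: (@unmatched_sub2 phi psi 0 n (leq0n n)). Qed.

(** A point matched in one round is absent from all later rounds; within one round, preferences are
    asymmetric. *)
Lemma matched_inj1 phi psi p x y :
  matched phi psi p x -> matched phi psi p y -> x = y.
Proof.
move=> [m hm] [n hn]; case: (ltngtP m n) => mn.
- have [pn _ _ _] := hn; have /unmatchedS1[_ []] := unmatched_sub1 mn pn.
  by exists x.
- have [pm _ _ _] := hm; have /unmatchedS1[_ []] := unmatched_sub1 mn pm.
  by exists y.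
- by rewrite mn in hm; exact: mutual_nearest_inj1 hm hn.
Qed.

Lemma matched_inj2 phi psi p q x :
  matched phi psi p x -> matched phi psi q x -> p = q.
Proof.
move=> [m hm] [n hn]; case: (ltngtP m n) => mn.
- have [_ pn _ _] := hn; have /unmatchedS2[_ []] := unmatched_sub2 mn pn.
  by exists p.
- have [_ pm _ _] := hm; have /unmatchedS2[_ []] := unmatched_sub2 mn pm.
  by exists q.
- by rewrite mn in hm; exact: mutual_nearest_inj2 hm hn.
Qed.

Lemma matched_refl phi psi p : phi p -> psi p -> matched phi psi p p.
Proof.
move=> phip psip; exists 0%N; split => //= y _ yp; left.
- rewrite subrr enorm0 lt_def enorm_ge0 andbT.
  by apply/eqP => /enorm_eq0/eqP; rewrite subr_eq0 => /eqP.
- rewrite subrr enorm0 lt_def enorm_ge0 andbT.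
  by apply/eqP => /enorm_eq0/eqP; rewrite subr_eq0 => /eqP.
Qed.

(** [tau] picks a partner by choice, on either side. If [z] in [phi] is also matched as a point of
    [psi], it lies in both sets, so it is matched to itself and this is its only partner. *)
Lemma tauE phi psi z t : phi z -> (tau phi psi z = Some t <-> matched phi psi z t).
Proof.
move=> phiz.
have partnerE y : partner phi psi z y <-> matched phi psi z y.
  split => [[//|yz]|]; last by left.
  have zz := matched_refl phiz (matched2 yz).
  by rewrite (matched_inj2 yz zz).
rewrite /tau; case: pselect => [a|[]]; last by left.
case: pselect => [h|h].
  have /= /partnerE hy := projT2 (cid h).
  split => [[<-//]|zt]; congr Some; exact: matched_inj1 hy zt.
by split => // zt; exfalso; apply: h; exists t; apply/partnerE.
Qed.

End preferences.

(** * Measurability of the matching and of the flower event *)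

Section lattice_points.
Variables (R : realType) (d : nat).

Definition lattice_pt (z : 'rV[int]_d) : 'rV[R]_d := map_mx intr z.

Lemma lattice_ptP x : lattice x <-> exists z, x = lattice_pt z.
Proof.
split => [xL|[z -> i]]; last by rewrite mxE intr_int.
have /fin_all_exists[f fE] (i : 'I_d) : exists a : int, x ord0 i = a%:~R.
  by have [a ->] := intrP (xL i); exists a.
by exists (\row_i f i); apply/rowP => i; rewrite !mxE fE.
Qed.

Lemma lattice0 : lattice (0 : 'rV[R]_d).
Proof. by move=> i; rewrite mxE rpred0. Qed.

End lattice_points.

Section measurable_matching.
Variables (R : realType) (d : nat).
Local Notation Rd := 'rV[R]_d.
Local Notation conf := (configuration R d).
Implicit Types (phi : conf) (f g : conf -> Rd).

Local Notation meas f := (measurable_fun setT (f : conf -> Rd)).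

Let mpt i : meas (pt i). Proof. exact: measurable_pt. Qed.

Let mlat z : meas (cst (lattice_pt R z)). Proof. exact: measurable_cst. Qed.

(** Here and in the next three lemmas a quantifier over points becomes a countable one; the guard
    makes the junk values of [pt] harmless. *)
Lemma ex_pt phi (Q : Rd -> Prop) : (forall x, Q x -> points phi x) ->
  (exists x, Q x) <-> (exists i, Q (pt i phi)).
Proof.
move=> Qphi; split => [[x Qx]|[i Qi]]; last by exists (pt i phi).
by have [i [_ E]] := pt_surj (Qphi _ Qx); exists i; rewrite E.
Qed.

Lemma all_pt phi (A : set Rd) (Q : Rd -> Prop) : A `<=` points phi ->
  (forall x, A x -> Q x) <-> (forall i, A (pt i phi) -> Q (pt i phi)).
Proof.
move=> Aphi; split => [h i /h//|h x Ax].
by have [i [_ E]] := pt_surj (Aphi _ Ax); rewrite -E; apply: h; rewrite E.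
Qed.

Lemma ex_lattice (Q : Rd -> Prop) : (forall x, Q x -> lattice x) ->
  (exists x, Q x) <-> (exists z, Q (lattice_pt R z)).
Proof.
move=> QL; split => [[x Qx]|[z Qz]]; last by exists (lattice_pt R z).
by have [z E] := (lattice_ptP x).1 (QL _ Qx); exists z; rewrite -E.
Qed.

Lemma all_lattice (A : set Rd) (Q : Rd -> Prop) : A `<=` lattice ->
  (forall x, A x -> Q x) <-> (forall z, A (lattice_pt R z) -> Q (lattice_pt R z)).
Proof.
move=> AL; split => [h i /h//|h x Ax].
by have [z E] := (lattice_ptP x).1 (AL _ Ax); rewrite E; apply: h; rewrite -E.
Qed.

(** Membership means being isolated by some cell; the clause [isolating i phi] excludes the junk
    value of [pt]. *)
Lemma measurable_mem_points f : meas f -> measurable [set phi | points phi (f phi)].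
Proof.
move=> mf.
rewrite (_ : [set _ | _] = [set phi | exists i, isolating i phi /\ pt i phi = f phi]).
  apply: measurable_pex => i; apply: measurable_pand.
    exact: measurable_count1 (measurable_cell i).
  exact: measurable_peq_rV.
apply/funext => phi; apply/propext; split => /= [/pt_surj//|[i [iso <-]]] /=.
have [x E] := (counting_eq1 R _).1 iso; rewrite (ptE E).
by have [] : (points phi `&` cell i) x by rewrite E.
Qed.

Lemma measurable_mem_lattice f : meas f -> measurable [set phi | lattice (f phi)].
Proof.
move=> mf.
rewrite (_ : [set _ | _] = [set phi | exists z, f phi = lattice_pt R z]).
  by apply: measurable_pex => z; exact: measurable_peq_rV.
by apply/funext => phi; apply/propext; exact: lattice_ptP.
Qed.

Let U n phi := unmatched lattice (points phi) n.

Let U1 n phi : (U n phi).1 `<=` lattice.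
Proof. exact: (@unmatched_sub1 _ _ _ _ 0 n (leq0n n)). Qed.

Let U2 n phi : (U n phi).2 `<=` points phi.
Proof. exact: (@unmatched_sub2 _ _ _ _ 0 n (leq0n n)). Qed.

Let measurable_mutual n :
  (forall f, meas f -> measurable [set phi | (U n phi).1 (f phi)]) ->
  (forall f, meas f -> measurable [set phi | (U n phi).2 (f phi)]) ->
  forall f g, meas f -> meas g ->
  measurable [set phi | mutual_nearest (U n phi).1 (U n phi).2 (f phi) (g phi)].
Proof.
move=> m1 m2 f g mf mg.
rewrite (_ : [set _ | _] = [set phi | ((U n phi).1 (f phi) /\ (U n phi).2 (g phi)) /\
  ((forall i, (U n phi).2 (pt i phi) ->
     (pt i phi <> g phi -> prefers1 (f phi) (g phi) (pt i phi))) /\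
   (forall z, (U n phi).1 (lattice_pt R z) ->
     (lattice_pt R z <> f phi -> prefers2 (g phi) (f phi) (lattice_pt R z))))]).
  apply: measurable_pand; apply: measurable_pand; [exact: m1|exact: m2| |].
    apply: measurable_pall => i; apply: measurable_pimply; first exact: m2.
    apply: measurable_pimply; last exact: measurable_prefers1.
    by apply: measurable_pnot; exact: measurable_peq_rV.
  apply: measurable_pall => z; apply: measurable_pimply; first exact: (m1 (cst _)).
  apply: measurable_pimply.
    by apply: measurable_pnot; exact: (@measurable_peq_rV _ _ _ _ (cst _)).
  exact: (measurable_prefers2 mg mf (mlat z)).
apply/funext => phi; apply/propext => /=; split.
  by move=> [h1 h2 /(all_pt _ (@U2 n phi)) h3 /(all_lattice _ (@U1 n phi)) h4].
move=> [[h1 h2] [/(all_pt (fun x => x <> g phi -> prefers1 (f phi) (g phi) x) (@U2 n phi)) h3]].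
by move=> /(all_lattice (fun z => z <> f phi -> prefers2 (g phi) (f phi) z) (@U1 n phi)).
Qed.

(** Both sides are treated together, and for every measurable [f] rather than a fixed point, since
    the next round quantifies over the random points [pt i]. *)
Lemma measurable_unmatched n :
  (forall f, meas f -> measurable [set phi | (U n phi).1 (f phi)]) /\
  (forall f, meas f -> measurable [set phi | (U n phi).2 (f phi)]).
Proof.
elim: n => [|n [m1 m2]].
  by split => f mf; [exact: measurable_mem_lattice|exact: measurable_mem_points].
split => f mf.
- rewrite (_ : [set _ | _] = [set phi | (U n phi).1 (f phi) /\
    ~ exists i, mutual_nearest (U n phi).1 (U n phi).2 (f phi) (pt i phi)]).
    apply: measurable_pand; first exact: m1.
    by apply/measurable_pnot/measurable_pex => i; exact: measurable_mutual.
  apply/funext => phi; apply/propext => /=.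
  rewrite -(@ex_pt phi (mutual_nearest (U n phi).1 (U n phi).2 (f phi))).
    exact: unmatchedS1.
  by move=> x [_ /U2].
- rewrite (_ : [set _ | _] = [set phi | (U n phi).2 (f phi) /\
    ~ exists z, mutual_nearest (U n phi).1 (U n phi).2 (lattice_pt R z) (f phi)]).
    apply: measurable_pand; first exact: m2.
    apply/measurable_pnot/measurable_pex => z.
    exact: (measurable_mutual m1 m2 (mlat z)).
  apply/funext => phi; apply/propext => /=.
  rewrite -(@ex_lattice (fun p => mutual_nearest (U n phi).1 (U n phi).2 p (f phi))).
    exact: unmatchedS2.
  by move=> x [/U1].
Qed.

Lemma measurable_matched f g : meas f -> meas g ->
  measurable [set phi | matched lattice (points phi) (f phi) (g phi)].
Proof.
move=> mf mg; apply: measurable_pex => n.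
by have [m1 m2] := measurable_unmatched n; exact: measurable_mutual.
Qed.

End measurable_matching.

Section far_flowers.
Variables (R : realType) (d : nat).
Local Notation Rd := 'rV[R]_d.
Local Notation conf := (configuration R d).
Implicit Types (phi : conf) (c : nat -> Rd) (r : R).
Hypothesis d0 : (0 < d)%N.

Lemma unit_vector (z : Rd) : exists2 u : Rd, enorm u = 1 & z = enorm z *: u.
Proof.
have [z0|z0] := eqVneq (enorm z) 0; last first.
  exists ((enorm z)^-1 *: z); last by rewrite scalerA mulfV// scale1r.
  by rewrite enormZ ger0_norm ?invr_ge0 ?enorm_ge0// mulVf.
(* For z = 0 any unit vector serves; a coordinate axis exists because d > 0. *)
exists (\row_j (j == Ordinal d0)%:R); last by rewrite z0 scale0r (enorm_eq0 z0).
rewrite /enorm (bigD1 (Ordinal d0))//= mxE eqxx big1 ?addr0 ?expr1n ?sqrtr1//.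
by move=> j /negbTE j0; rewrite mxE j0 expr0n.
Qed.

(** The point of the ball farthest from the origin is z + rho z / |z|. This replaces an uncountable
    quantifier over [y] by an inequality. *)
Lemma cball_far (z : Rd) (rho r : R) : 0 <= rho ->
  (exists2 y, cball z rho y & r < enorm y) <-> r < enorm z + rho.
Proof.
move=> rho0; split => [[y yz ry]|rz].
  rewrite (lt_le_trans ry)// -[y in leLHS](subrK z) addrC.
  by rewrite (le_trans (ler_enormD _ _))// lerD2l.
have [u u1 zu] := unit_vector z; exists (z + rho *: u).
  by rewrite /cball /= addrAC subrr add0r enormZ u1 mulr1 ger0_norm.
rewrite [X in enorm (X + _)]zu -scalerDl enormZ u1 mulr1.
by rewrite ger0_norm// addr_ge0// enorm_ge0.
Qed.

Definition far_region r n c :=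
  r < enorm (c 1%N) + enorm (c 1%N - c 2) \/
  exists i, (2 <= i <= n)%N /\ r < enorm (c i) + enorm (c i - c i.-1).

Lemma chain_region_far r n c :
  (exists2 y, chain_region n c y & r < enorm y) <-> far_region r n c.
Proof.
split => [[y [y1|[i i2 yi]] ry]|[|[i [i2]]]].
- by left; apply/(cball_far _ _ (enorm_ge0 _)); exists y.
- by right; exists i; split => //; apply/(cball_far _ _ (enorm_ge0 _)); exists y.
- by move/(cball_far _ _ (enorm_ge0 _)) => [y y1 ry]; exists y => //; left.
- move/(cball_far _ _ (enorm_ge0 _)) => [y yi ry]; exists y => //.
  by right; exists i.
Qed.

Let anchored phi c := exists i,
  matched lattice (points phi) 0 (pt i phi) /\
  (c 2 = pt i phi \/ prefers1 0 (c 2) (pt i phi)).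

Let far_chain r n c phi :=
  (descending_chain lattice (points phi) n c /\ c 1%N = 0) /\
  (anchored phi c /\ far_region r n c).

Lemma flower_farE r phi : ~ (flower lattice (points phi) 0 `<=` cball 0 r) <->
  (~ exists i, matched lattice (points phi) 0 (pt i phi)) \/
  exists n c, far_chain r n c phi.
Proof.
have ex_pt0 (Q : Rd -> Prop) :
    (exists t, matched lattice (points phi) 0 t /\ Q t) <->
    (exists i, matched lattice (points phi) 0 (pt i phi) /\ Q (pt i phi)).
  apply: (@ex_pt R d phi (fun t => matched lattice (points phi) 0 t /\ Q t)).
  by move=> x [/matched2].
have anchoredP c : (exists t, tau lattice (points phi) 0 = Some t /\
    (c 2 = t \/ prefers1 0 (c 2) t)) <-> anchored phi c.
  rewrite /anchored -(ex_pt0 (fun t => c 2 = t \/ prefers1 0 (c 2) t)).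
  by split => -[t [/tauE h1 h2]]; exists t; split => //; apply: h1; exact: lattice0.
have not_sub (A : set Rd) :
    ~ (A `<=` cball 0 r) <-> exists2 y, A y & r < enorm y.
  split=> [/existsNP[y /not_implyP[Ay]]|[y Ay ry] /(_ _ Ay)].
    by rewrite /cball /= subr0 => /negP; rewrite -ltNge; exists y.
  by rewrite /cball /= subr0 leNgt ry.
rewrite not_sub /flower; case tE: (tau lattice (points phi) 0) => [t|]; last first.
  split => [_|_]; first left.
    move=> [i /(tauE _ _ (@lattice0 R d))]; by rewrite tE.
  (* Without a partner the flower is the whole space; the radius |r| + 1 exceeds [r] whatever its
     sign. *)
  have [||y _ ry] := (cball_far 0 (rho := `|r| + 1) r _).2; last by exists y.
    by rewrite addr_ge0.
  by rewrite enorm0 add0r (le_lt_trans (ler_norm r))// ltrDl.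
split.
  move=> [y [n [c [[h1 h2 h3] yc]]] ry]; right; exists n, c; split => //.
  by split; [exact/anchoredP|apply/chain_region_far; exists y].
move=> [[]|[n [c [[h1 h2] [h3 /chain_region_far[y yc ry]]]]]].
  have /tauE mt := tE; have [i [_ iE]] := pt_surj (matched2 (mt (@lattice0 R d))).
  by exists i; rewrite iE; apply: mt; exact: lattice0.
by exists y => //; exists n, c; split => //; split => //; apply/anchoredP.
Qed.

Local Notation node := ('rV[int]_d * ('rV[rat]_d * nat))%type.

(** Chains are coded by finite words over a countable alphabet. A node carries a lattice point and a
    cell, and the parity of its position selects which one is read. *)
Let word_chain (s : seq node) phi (k : nat) : Rd :=
  if odd k then lattice_pt R (nth (0, (0, 0%N)) s k).1
  else pt (nth (0, (0, 0%N)) s k).2 phi.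

Let measurable_word_chain s k : measurable_fun setT (word_chain s ^~ k).
Proof.
rewrite /word_chain; case: (odd k); first exact: measurable_cst.
exact: measurable_pt.
Qed.

Let far_chain_word r n c phi : far_chain r n c phi ->
  exists s, far_chain r n (word_chain s phi) phi.
Proof.
move=> [[[n2 mem pref] c1] [anc far]].
have /choice[g gE] (k : nat) : exists x : node, (1 <= k <= n)%N ->
    c k = if odd k then lattice_pt R x.1 else pt x.2 phi.
  have [kn|] := boolP (1 <= k <= n)%N; last by exists (0, (0, 0%N)).
  have := mem k kn; case: ifP => _.
    by move/lattice_ptP => [z ->]; exists (z, (0, 0%N)).
  by move/pt_surj => [i [_ <-]]; exists (0, i).
(* The word has n + 1 letters because chains start at index 1; letter 0 is a dummy. *)
exists (mkseq g n.+1); set c' := word_chain _ _.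
have cE k : (1 <= k <= n)%N -> c' k = c k.
  by move=> kn; rewrite gE// /c' /word_chain nth_mkseq// ltnS; case/andP: kn.
split; split.
- split => //.
    by move=> i i1n; rewrite cE//; exact: mem.
  move=> i i2n; have := pref i i2n; rewrite !cE//; lia.
- by rewrite cE//; lia.
- by case: anc => i [h1 h2]; exists i; rewrite cE//; lia.
- case: far => [far|[i [i2 far]]]; first by left; rewrite !cE//; lia.
  by right; exists i; split => //; rewrite !cE//; lia.
Qed.

Let measurable_far_chain r n s :
  measurable [set phi | far_chain r n (word_chain s phi) phi].
Proof.
have mc := measurable_word_chain s.
have m0 : measurable_fun setT (cst 0 : conf -> Rd) by exact: measurable_cst.
have mpt i := @measurable_pt R d i.
apply: measurable_pand; apply: measurable_pand.
- rewrite (_ : [set _ | _] = [set phi | (2 <= n)%N /\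
    ((forall i, (1 <= i <= n)%N -> if odd i then lattice (word_chain s phi i)
       else points phi (word_chain s phi i)) /\
     (forall i, (2 <= i <= n.-1)%N -> if odd i
       then prefers1 (word_chain s phi i) (word_chain s phi i.+1) (word_chain s phi i.-1)
       else prefers2 (word_chain s phi i) (word_chain s phi i.+1) (word_chain s phi i.-1)))]).
    apply: measurable_pand; first exact: measurable_pcst.
    apply: measurable_pand; apply: measurable_pall => i;
      apply: measurable_pimply; try exact: measurable_pcst; case: (odd i).
    + exact: measurable_mem_lattice.
    + exact: measurable_mem_points.
    + exact: measurable_prefers1.
    + exact: measurable_prefers2.
  by apply/funext => phi; apply/propext; split => [[]|[? []]].
- exact: (measurable_peq_rV (mc 1%N) m0).
- apply: measurable_pex => i; apply: measurable_pand.
    exact: (measurable_matched m0).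
  apply: measurable_por; first exact: measurable_peq_rV.
  exact: (measurable_prefers1 m0).
- have mr : measurable_fun setT (cst r : conf -> R) by exact: measurable_cst.
  have mE i j : measurable_fun setT (fun phi => enorm (word_chain s phi i) +
      enorm (word_chain s phi i - word_chain s phi j)).
    by apply: measurable_funD; [exact: measurable_enorm|exact: measurable_enormB].
  apply: measurable_por; first exact: (measurable_plt mr).
  apply: measurable_pex => i; apply: measurable_pand; first exact: measurable_pcst.
  exact: (measurable_plt mr).
Qed.

Lemma measurable_far_flower r :
  measurable [set phi : conf | ~ (flower lattice (points phi) 0 `<=` cball 0 r)].
Proof.
rewrite (_ : [set _ | _] = [set phi : conf |
  (~ exists i, matched lattice (points phi) 0 (pt i phi)) \/
  exists n s, far_chain r n (word_chain s phi) phi]); last first.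
  apply/funext => phi; apply/propext; split => /= [/flower_farE[h|[n [c]]]|].
  - by left.
  - by move=> /far_chain_word[s h]; right; exists n, s.
  - move=> [h|[n [s h]]]; apply/flower_farE; first by left.
    by right; exists n, (word_chain s phi).
apply: measurable_por.
  apply/measurable_pnot/measurable_pex => i.
  apply: (@measurable_matched _ _ (cst 0)); first exact: measurable_cst.
  exact: measurable_pt.
by apply: measurable_pex => n; apply: measurable_pex => s; exact: measurable_far_chain.
Qed.

Lemma measurable_tau_far (s : R) : measurable
  [set phi : conf | (s%:E < enorm_oo (tau lattice (points phi) 0))%E].
Proof.
rewrite (_ : [set _ | _] = [set phi : conf | ~ exists i,
  matched lattice (points phi) 0 (pt i phi) /\ enorm (pt i phi) <= s]).
  apply/measurable_pnot/measurable_pex => i; apply: measurable_pand.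
    apply: (@measurable_matched _ _ (cst 0)); first exact: measurable_cst.
    exact: measurable_pt.
  apply: measurable_ple; last exact: measurable_cst.
  by apply: measurable_enorm; exact: measurable_pt.
apply/funext => phi; apply/propext => /=.
have L0 := @lattice0 R d.
split.
  case tE: (tau _ _ _) => [t|] /= h [i [/(tauE _ _ L0)]]; last by rewrite tE.
  by rewrite tE => -[<-]; rewrite leNgt -lte_fin h.
move=> h; case tE: (tau _ _ _) => [t|] /=; last exact: ltry.
rewrite lte_fin ltNge; apply/negP => ts; apply: h.
have mt := (tauE _ _ L0).1 tE; have [i [_ iE]] := pt_surj (matched2 mt).
by exists i; rewrite iE.
Qed.

End far_flowers.

(** * Choice of the parameters *)

Section estimates.
Variable R : realType.
Implicit Types (r s theta C delta : R).

Lemma bin_le_exp2 m n : ('C(m, n) <= 2 ^ m)%N.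
Proof.
have [nm|mn] := leqP n m; last by rewrite bin_small.
rewrite -[2%N]/(1 + 1)%N expnDn (bigD1 (Ordinal (nm : (n < m.+1)%N)))//=.
by rewrite !exp1n !muln1 leq_addr.
Qed.

(** As 1 <= s and K <= 2s, one has 2K + 1 <= 5s; the binomial coefficient is at most 4^n. *)
Lemma chain_count_le d n K s theta c kap : 1 <= s -> (0 < n)%N -> 0 <= c ->
  0 <= kap -> K%:R <= s + s ->
  n%:R `^ (theta * n%:R) * c ^+ n *
    ((kap * (s ^+ d / n%:R)) ^+ n *+ (K.*2.+1 ^ (n * d) * 'C(n + n, n))) <=
  (n%:R `^ theta / n%:R * (4 * c * kap * 5 ^+ d) * s ^+ (2 * d)) ^+ n.
Proof.
move=> s1 n0 c0 k0 Ks; have s0 : 0 <= s by exact: le_trans s1.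
have v0 : 0 <= kap * (s ^+ d / n%:R) by rewrite mulr_ge0// divr_ge0// exprn_ge0.
have K5 : K.*2.+1%:R <= 5 * s by rewrite -natr1 -muln2 natrM; lra.
have -> : n%:R `^ theta / n%:R * (4 * c * kap * 5 ^+ d) * s ^+ (2 * d) =
    n%:R `^ theta * c * (kap * (s ^+ d / n%:R) * ((5 * s) ^+ d * 4)).
  by rewrite exprMn mulSn mul1n exprD; field; rewrite pnatr_eq0 -lt0n.
rewrite powRrM powR_mulrn ?powR_ge0// -[_ ^+ n *+ _]mulr_natr natrM natrX.
rewrite [(n * d)%N]mulnC exprM.
have -> (a b w q : R) : (a * b * (w * (q * 4))) ^+ n =
    a ^+ n * b ^+ n * (w ^+ n * (q ^+ n * 4 ^+ n)) by rewrite !exprMn.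
rewrite ler_wpM2l ?mulr_ge0 ?exprn_ge0 ?powR_ge0// ler_wpM2l ?exprn_ge0//.
apply: ler_pM; rewrite ?exprn_ge0//.
  by rewrite lerXn2r ?nnegrE ?exprn_ge0 ?mulr_ge0// lerXn2r ?nnegrE ?mulr_ge0.
rewrite (_ : 4 = (2 ^ 2)%:R)// -natrX ler_nat -expnM mul2n -addnn.
exact: bin_le_exp2.
Qed.

(** Put eta = 1 - theta and D = 2d + eta. Then s^D <= eps r^eta by the choice of the exponent of
    [s], and r^eta <= 4 n^eta s^eta. *)
Lemma chain_factor_le d n theta C eps e r : (0 < d)%N -> 0 <= theta < 1 -> 0 <= C ->
  0 < eps <= 1 -> 4 * C * eps <= e -> 0 < r -> (0 < n)%N ->
  let s := eps * r `^ ((1 - theta) / ((2 * d + 1)%:R - theta)) in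
  r <= n%:R * (4 * s) ->
  n%:R `^ theta / n%:R * C * s ^+ (2 * d) <= e.
Proof.
move=> d0 /andP[t0 t1] C0 /andP[e0 e1] Ce r0 n0 s rn.
pose eta := 1 - theta; have eta0 : 0 < eta by rewrite /eta subr_gt0.
have DE : (2 * d + 1)%:R - theta = (2 * d)%:R + eta by rewrite natrD /eta; ring.
have D1 : eta <= (2 * d)%:R + eta by rewrite lerDr.
have s0 : 0 < s by rewrite mulr_gt0// powR_gt0.
have N0 : 0 < n%:R :> R by rewrite ltr0n.
have nE : n%:R `^ theta / n%:R = (n%:R `^ eta)^-1.
  apply: (mulIf (lt0r_neq0 (powR_gt0 eta N0))); rewrite mulVf ?lt0r_neq0 ?powR_gt0//.
  rewrite mulrAC -powRD; last by rewrite lt0r_neq0 ?implybT.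
  by rewrite /eta addrC subrK powRr1 ?ltW// divff// lt0r_neq0.
have D2 : 1 <= (2 * d)%:R + eta.
  by apply: (@le_trans _ _ (2 * d)%:R); [rewrite ler1n muln_gt0|rewrite lerDl ltW].
have sE : s ^+ (2 * d) * s `^ eta <= eps * r `^ eta.
  rewrite -powR_mulrn; last exact: ltW.
  rewrite -powRD; last by rewrite lt0r_neq0 ?implybT.
  apply: (@le_trans _ _ (eps * (r `^ (eta / ((2 * d)%:R + eta))) `^ ((2 * d)%:R + eta))).
    rewrite /s DE; apply: ge1r_powRZ => //; first by rewrite e0.
    exact: powR_ge0.
  by rewrite -powRrM divfK// lt0r_neq0// (lt_le_trans ltr01).
have rE : r `^ eta <= n%:R `^ eta * (4 * s `^ eta).
  have h : r `^ eta <= (n%:R * (4 * s)) `^ eta.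
    apply: (ge0_ler_powR (ltW eta0) _ _ rn); rewrite nnegrE; first exact: ltW.
    by rewrite mulr_ge0// mulr_ge0// ltW.
  apply: le_trans h _; rewrite powRM//; last by rewrite mulr_ge0// ltW.
  rewrite powRM//; last exact: ltW.
  rewrite ler_wpM2l ?powR_ge0//.
  rewrite ler_wpM2r ?powR_ge0// ler1_powR//; last by rewrite /eta gerBl.
  by rewrite ler1n.
have re0 : 0 < r `^ eta by exact: powR_gt0.
have ne0 : 0 < n%:R `^ eta by exact: powR_gt0.
rewrite nE -mulrA ler_pdivrMl//.
(* The factor r^eta brings in s^eta, which completes s^(2d) to s^D. *)
rewrite -(ler_pM2r re0).
have S0 : 0 <= s ^+ (2 * d) by rewrite exprn_ge0// ltW.
apply: (@le_trans _ _ (C * s ^+ (2 * d) * (n%:R `^ eta * (4 * s `^ eta)))).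
  by rewrite ler_wpM2l// mulr_ge0.
have -> : C * s ^+ (2 * d) * (n%:R `^ eta * (4 * s `^ eta)) =
  n%:R `^ eta * (4 * C) * (s ^+ (2 * d) * s `^ eta) by ring.
apply: (@le_trans _ _ (n%:R `^ eta * (4 * C) * (eps * r `^ eta))).
  by rewrite ler_wpM2l// !mulr_ge0 ?powR_ge0.
have -> : n%:R `^ eta * (4 * C) * (eps * r `^ eta) =
  n%:R `^ eta * (4 * C * eps) * r `^ eta by ring.
by rewrite ler_wpM2r ?powR_ge0// ler_wpM2l ?powR_ge0.
Qed.

End estimates.

(** * Union bound and conclusion *)

Section far_probability.
Variables (R : realType) (d : nat) (dO : measure_display)
  (Omega : measurableType dO) (P : probability Omega R)
  (Psi : {RV P >-> configuration R d}) (c theta c1 delta : R).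
Hypotheses (d0 : (0 < d)%N) (c0 : 0 < c) (theta01 : 0 <= theta < 1)
  (c10 : 0 < c1) (delta0 : 0 < delta).
Hypothesis corr : forall n : nat, (0 < n)%N ->
  exists2 rho : 'M[R]_(n, d) -> \bar R,
    is_correlation_function Psi rho &
    forall x, (rho x <= (n%:R `^ (theta * n%:R) * c ^+ n)%:E)%E.
Hypothesis tail : forall r : R, 0 <= r ->
  (P [set w | (r%:E < enorm_oo (tau lattice (Psi w) 0))%E]
    <= (c1 * expR (- (c1^-1 * r `^ delta)))%:E)%E.

Let far r := [set w | ~ (flower lattice (Psi w) 0 `<=` cball 0 r)].
Let far_partner (s : R) := [set w | (s%:E < enorm_oo (tau lattice (Psi w) 0))%E].

Lemma measurable_far r : measurable (far r).
Proof.
have := measurable_funP Psi measurableT _ (measurable_far_flower d0 r).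
by rewrite setTI.
Qed.

Lemma measurable_far_partner s : measurable (far_partner s).
Proof.
have := measurable_funP Psi measurableT _ (measurable_tau_far s).
by rewrite setTI.
Qed.

(** Either the partner of 0 is farther than [s], which has the assumed tail, or a far flower yields
    the tuples counted by the first moment bound. *)
Lemma probability_far_le (r s e : R) n : 1 <= s -> (0 < n)%N ->
  s *+ n.*2 <= r ->
  n%:R `^ theta / n%:R * (4 * c * kappa R d * 5 ^+ d) * s ^+ (2 * d) <= e ->
  (P (far r) <= (c1 * expR (- (c1^-1 * s `^ delta)) + e ^+ n)%:E)%E.
Proof.
move=> s1 n0 snr he; have s0 : 0 < s by exact: lt_le_trans s1.
have mf := measurable_far r; have mp := measurable_far_partner s.
have -> : far r = far r `&` far_partner s `|` far r `\` far_partner s by rewrite setUIDK.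
apply: (@le_trans _ _ (P (far_partner s) + P (far r `\` far_partner s))%E).
  rewrite (le_trans (measureU2 _ _ _))//; [exact: measurableI|exact: measurableD|].
  rewrite leeD2r// le_measure ?inE//; exact: measurableI.
rewrite EFinD leeD//; first by apply: tail; exact: ltW.
have [rho rhoP rhoM] := corr n0.
(* Increments of the lattice path have norm at most 2s. *)
pose K := Num.truncn (s + s).
have s20 : 0 <= s + s by rewrite addr_ge0// ltW.
have /andP[Ks sK] := truncn_itv s20.
have M0 : 0 <= n%:R `^ (theta * n%:R) * c ^+ n.
  by rewrite mulr_ge0 ?powR_ge0// exprn_ge0// ltW.
apply: le_trans (chain_probability_le d0 n0 s0 sK M0 rhoP rhoM _ _) _.
- exact: measurableD.
- move=> w [farw /= nearw]; rewrite /far_partner /= in nearw.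
  case tE: (tau lattice (Psi w) 0) nearw => [t|] /= => [ts|]; last by rewrite ltry.
  apply: far_flower_tuple tE farw => //.
  by rewrite leNgt -lte_fin; exact/negP.
rewrite lee_fin; have k0 : 0 <= kappa R d by exact: kappa_ge0.
apply: le_trans (@chain_count_le _ d n K s theta c _ s1 n0 (ltW c0) k0 Ks) _.
set b := (X in X ^+ n <= _) in he *; have b0 : 0 <= b.
  have s0' := ltW s0; have c0' := ltW c0.
  by rewrite !mulr_ge0 ?exprn_ge0 ?invr_ge0 ?powR_ge0.
by apply: lerXn2r => //; rewrite nnegrE// (le_trans b0).
Qed.

End far_probability.

Theorem theorem5p5 (R : realType) (d : nat)
    (dO : measure_display) (Omega : measurableType dO)
    (P : probability Omega R) (Psi : {RV P >-> configuration R d})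
    (c theta c1 delta : R) :
  stationary Psi ->
  (1 <= intensity Psi)%E ->
  0 < c ->
  0 <= theta < 1 ->
  (forall n : nat, (0 < n)%N ->
     exists2 rho : 'M[R]_(n, d) -> \bar R,
       is_correlation_function Psi rho &
       forall x, (rho x <= (n%:R `^ (theta * n%:R) * c ^+ n)%:E)%E) ->
  0 < c1 ->
  0 < delta ->
  (forall r : R, 0 <= r ->
     (P [set w | (r%:E < enorm_oo (tau lattice (Psi w) 0))%E]
      <= (c1 * expR (- (c1^-1 * r `^ delta)))%:E)%E) ->
  let beta : R :=
    Num.min ((1 - theta) * delta) (2 * d)%:R / ((2 * d + 1)%:R - theta) in
  exists2 c2 : R, 0 < c2 &
    forall r : R, 0 < r ->
      (P [set w | ~ (flower lattice (Psi w) 0 `<=` cball 0 r)]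
       <= (c2 * expR (- (c2^-1 * r `^ beta)))%:E)%E.
Proof.
move=> _ _ c0 theta01 corr c10 delta0 tail beta.
(* In dimension 0 the space is a single point, so the event is empty. *)
have [d0|d0] := posnP d.
  exists 1 => // r r0; rewrite (_ : [set _ | _] = set0).
    by rewrite measure0 lee_fin mulr_ge0// expR_ge0.
  apply/seteqP; split => // w /= h; exfalso; apply: h => y _.
  rewrite /cball /= subr0 /enorm big1 ?sqrtr0 ?ltW// => i _.
  by have := ltn_ord i; rewrite [X in (_ < X)%N]d0.
have /andP[t0 t1] := theta01.
have eta0 : 0 < 1 - theta by rewrite subr_gt0.
have D2 : 1 <= (2 * d)%:R :> R by rewrite ler1n muln_gt0.
pose D := (2 * d + 1)%:R - theta.
have DE : D = (2 * d)%:R + (1 - theta) by rewrite /D natrD; ring.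
have D0 : 0 < D by rewrite DE; lra.
(* With s of order r^g, the partner contributes the exponent g delta, and the number of steps, of
   order r/s, the exponent 1 - g = 2d / D; [beta] is the smaller of the two. *)
pose g := (1 - theta) / D.
have g0 : 0 < g by rewrite divr_gt0.
have g1 : g <= 1 by rewrite ler_pdivrMr// mul1r DE; lra.
have gE : 1 - g = (2 * d)%:R / D.
  apply: (mulIf (lt0r_neq0 D0)); rewrite mulrBl mul1r /g !divfK ?lt0r_neq0//.
  by rewrite DE; ring.
have betag : beta <= g * delta.
  by rewrite /beta /g mulrAC ler_pM2r ?invr_gt0// ge_min lexx.
have beta1g : beta <= 1 - g.
  by rewrite gE ler_pM2r ?invr_gt0// ge_min lexx orbT.
have beta0 : 0 <= beta.
  apply: divr_ge0; last exact: ltW.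
  by rewrite le_min (ltW (mulr_gt0 eta0 delta0)) (le_trans ler01).
pose C := 4 * c * kappa R d * 5 ^+ d.
have C0 : 0 <= C by rewrite !mulr_ge0 ?exprn_ge0 ?kappa_ge0// ltW.
pose e := expR (- 1) : R.
have e0 : 0 < e by exact: expR_gt0.
have e2 : e <= 1 / 2.
  have := expR_ge1Dx (1 : R); rewrite /e expRN => h.
  by rewrite div1r lef_pV2 ?posrE ?expR_gt0//; lra.
(* Small enough for [chain_factor_le] to bound the factor per step by exp(-1), and at most 1/2 so
   that 2s <= r. *)
pose eps := e / (4 * C + 1).
have eps0 : 0 < eps by rewrite divr_gt0//; lra.
have eps2 : eps <= 1 / 2.
  apply: le_trans e2; rewrite ler_pdivrMr; last lra.
  by have := mulr_ge0 (ltW e0) C0; lra.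
have Ceps : 4 * C * eps <= e.
  by rewrite /eps mulrA ler_pdivrMr; lra.
(* The value of r at which eps r^g = 1; beyond it s >= 1. *)
pose r0 := eps^-1 `^ g^-1.
have r01 : 1 <= r0.
  apply: (@le_trans _ _ (eps^-1 `^ 0)); first by rewrite powRr0.
  by apply: ler_powR; [rewrite invf_ge1//; lra|rewrite invr_ge0 ltW].
(* The first rate comes from the tail at s = eps r^g, the second from n >= r / (4s) = r^(1-g) / (4
   eps). *)
pose a := Num.min (c1^-1 * eps `^ delta) (4 * eps)^-1.
have a0 : 0 < a by rewrite lt_min mulr_gt0 ?invr_gt0 ?powR_gt0// mulr_gt0.
have far_r (r : R) : r0 <= r ->
    (P [set w | ~ (flower lattice (Psi w) 0 `<=` cball 0 r)] <=
     ((c1 + 1) * expR (- (a * r `^ beta)))%:E)%E.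
  move=> r0r; have r1 : 1 <= r by exact: le_trans r0r.
  have rpos : 0 < r by exact: lt_le_trans r1.
  have rg0 : 0 < r `^ g by exact: powR_gt0.
  pose s := eps * r `^ g.
  have s1 : 1 <= s.
    rewrite -(mulfV (lt0r_neq0 eps0)) ler_pM2l//.
    have -> : eps^-1 = r0 `^ g.
      by rewrite -powRrM mulVf ?lt0r_neq0// powRr1// invr_ge0 ltW.
    by apply: ge0_ler_powR; rewrite ?nnegrE ?(ltW g0) ?(ltW rpos) ?powR_ge0.
  have s0 : 0 < s by exact: lt_le_trans s1.
  have s2r : 2 * s <= r.
    have h : r `^ g <= r by exact: ler1_powR.
    apply: le_trans h; rewrite /s mulrA -[leRHS]mul1r ler_pM2r//; lra.
  pose u := r / (2 * s); have u1 : 1 <= u by rewrite ler_pdivlMr ?mul1r// mulr_gt0.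
  have u0 : 0 <= u by exact: le_trans u1.
  (* The largest n with 2ns <= r. Since n >= 1, also u < n + 1 <= 2n, that is, r <= 4ns up to
     equality. *)
  pose n := Num.truncn u.
  have n0 : (0 < n)%N by rewrite truncn_ge_nat.
  have /andP[nu un] := truncn_itv u0.
  have n1R : 1 <= n%:R :> R by rewrite ler1n.
  have snr : s *+ n.*2 <= r.
    have : n%:R * (2 * s) <= r by rewrite -ler_pdivlMr// mulr_gt0.
    by rewrite -[s *+ _]mulr_natr -muln2 natrM; lra.
  have rn : r <= n%:R * (4 * s).
    have : r <= 2 * n%:R * (2 * s).
      have un' : u < n%:R + 1 by rewrite natr1.
      by rewrite -ler_pdivrMr; [rewrite -/u; lra|exact: mulr_gt0].
    by lra.
  have eps01 : 0 < eps <= 1 by apply/andP; split => //; lra.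
  have fac := chain_factor_le d0 theta01 C0 eps01 Ceps rpos n0 rn.
  apply: le_trans (probability_far_le d0 c0 corr tail s1 n0 snr fac) _.
  rewrite lee_fin mulrDl mul1r; apply: lerD.
    rewrite ler_pM2l// ler_expR lerN2 /s powRM ?powR_ge0 ?(ltW eps0)//.
    rewrite -powRrM mulrA; apply: ler_pM; rewrite ?powR_ge0 ?(ltW a0)//.
      by rewrite ge_min lexx.
    exact: ler_powR.
  rewrite /e -expRM_natl ler_expR mulrN1 lerN2.
  have h : r `^ (1 - g) <= n%:R * (4 * eps).
    rewrite -(ler_pM2r rg0) -powRD; last by rewrite lt0r_neq0 ?implybT.
    by rewrite subrK powRr1 ?(ltW rpos)// (le_trans rn)// /s !mulrA.
  apply: (@le_trans _ _ ((4 * eps)^-1 * r `^ (1 - g))).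
    apply: ler_pM; rewrite ?powR_ge0 ?(ltW a0)//; last exact: ler_powR.
    by rewrite ge_min lexx orbT.
  by rewrite ler_pdivrMl; [rewrite [leRHS]mulrC|exact: mulr_gt0].
(* The summand c1 + 1 dominates the prefactor, [a^-1] makes the rate at most [a], and the
   exponential makes the bound at least 1 for r < r0. *)
pose c2 := c1 + 1 + a^-1 + expR (r0 `^ beta).
have E0 := expR_gt0 (r0 `^ beta); have ai0 : 0 < a^-1 by rewrite invr_gt0.
have c2pos : 0 < c2 by rewrite /c2; lra.
exists c2 => // r rpos; have [r0r|rr0] := leP r0 r.
  apply: le_trans (far_r r r0r) _; rewrite lee_fin.
  apply: ler_pM; rewrite ?expR_ge0//; [lra|rewrite /c2; lra|].
  rewrite ler_expR lerN2 ler_wpM2r ?powR_ge0// -[leRHS]invrK lef_pV2 ?posrE//.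
  by rewrite /c2; lra.
apply: (@le_trans _ _ 1%E).
  by apply: probability_le1; exact: measurable_far.
rewrite lee_fin -(expRxMexpNx_1 (r0 `^ beta)).
apply: ler_pM; rewrite ?expR_ge0//; first by rewrite /c2; lra.
rewrite ler_expR lerN2 -[leRHS]mul1r; apply: ler_pM; rewrite ?powR_ge0 ?invr_ge0 ?(ltW c2pos)//.
  by rewrite invf_le1// /c2; lra.
by apply: ge0_ler_powR; rewrite ?nnegrE ?(ltW rpos) ?(ltW rr0)// (le_trans ler01).
Qed.
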